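(* Let $L_1<L_2$ be two broken lines in $M_{m,n}(\mathbb{Z}_+)$ such that $L_2$ is a closest bigger line to $L_1$. Let $\mathcal{Q}_{L_1}=(\mathcal{V}_{L_1},\Lambda_{L_1},B_{L_1})$ and $\mathcal{Q}_{L_2}=(\mathcal{V}_{L_2},\Lambda_{L_2},B_{L_2})$ be quantum seeds corresponding to these lines such that the set of non-mutable elements in both cases is $\mathcal{C}=\mathcal{C}^-_{L^+}$. Then $\mathcal{Q}_{L_1}$ can be obtained from $\mathcal{Q}_{L_2}$ through a sequence of moves which alternate between modifications to the $B$ matrix at a given step (replacing a quantum seed $(\mathcal{V},\Lambda,B)$ by a quantum seed $(\mathcal{V},\Lambda,\tilde B)$ with the same variables and the same $\Lambda$) and quantum mutations. The modifications to the $B$ matrices do not affect their principal parts.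
   Context: **Quantum matrices.** $K=\mathbb{Q}(q)$. $\mathcal{O}_q(M(m,n))$ is the associative $K$-algebra generated by $Z_{i,j}$ ($1\le i\le m$, $1\le j\le n$) with relations $Z_{ij}Z_{ik}=q^2Z_{ik}Z_{ij}$ if $j<k$; $Z_{ij}Z_{kj}=q^2Z_{kj}Z_{ij}$ if $i<k$; $Z_{ij}Z_{st}=Z_{st}Z_{ij}$ if $i>s,\ j<t$; $Z_{ij}Z_{st}=Z_{st}Z_{ij}+(q^2-q^{-2})Z_{it}Z_{sj}$ if $i<s,\ j<t$. For $I=\{i_1<\dots<i_r\}$ (rows), $J=\{j_1<\dots<j_r\}$ (columns), $\xi^I_J=\sum_{\sigma\in S_r}(-q^2)^{\ell(\sigma)}Z_{i_1,j_{\sigma(1)}}\cdots Z_{i_r,j_{\sigma(r)}}$ is a quantum minor, solid if $I,J$ consist of consecutive integers. **Broken lines.** A broken line $L$ in $M_{m,n}(\mathbb{Z}_+)$ is a lattice path from $(1,n)$ to $(m,1)$ each of whose unit steps lowers the column number by 1 or raises the row number by 1; it is identified with its set of lattice points. Every diagonal $\{i-j=\text{const}\}$ of the rectangle meets $L$ exactly once. $S_L$ (points above $L$): those $(i,j)\notin L$ with $(i+t,j+t)\in L$ for some $t>0$; $T_L$ (points below $L$): those $(i,j)\notin L$ with $(i-t,j-t)\in L$ for some $t>0$. $L_1\le L_2$ iff $S_{L_2}\subseteq S_{L_1}$. $L_2$ is a closest bigger line to $L_1$ if $L_1<L_2$ and there is no broken line strictly between. $L^-:(1,n)\to(m,n)\to(m,1)$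 is the smallest and $L^+:(1,n)\to(1,1)\to(m,1)$ the largest broken line. **Variables.** $\mathcal{V}_L$ is the family of $mn$ pairwise $q$-commuting (i.e. $xy=q^{2p}yx$, $p\in\mathbb{Z}$) quantum minors indexed by points: for $(i,j)\in T_L\cup L$, the biggest solid minor with bottom right corner $(i,j)$ contained in $T_L\cup L$; for $(i,j)\in S_L$, the biggest solid minor with upper left corner $(i,j)$. $\mathcal{C}^-_{L^+}$ is the set of the $m+n-1$ variables of $\mathcal{V}_{L^+}$ indexed by the points of $L^-$; these belong to every $\mathcal{V}_L$. **Quantum seeds.** All seeds are in the skew field of fractions of $\mathcal{O}_q(M(m,n))$. The $\Lambda$-matrix of $q$-commuting variables $x_1,\dots,x_N$ is the skew-symmetric integer matrix $(\lambda_{ij})$ with $x_ix_j=q^{2\lambda_{ij}}x_jx_i$. For an integer $N\times|ex|$ matrix $B=(b_{kj})$ with columns labeled by $ex\subseteq\{1,\dots,N\}$ (mutable indices; others are non-mutable), $(\Lambda,B)$ is a compatible pair if $\sum_kb_{kj}\lambda_{ki}=2\delta_{ij}$ for all $j\in ex$ and all $i$. The principal part of $B$ is its sub-matrix with rows in $ex$. A quantum seed is $(\{x_1,\dots,x_N\},\Lambda,B)$ with $(\Lambda,B)$ compatible. Put $x(\underline a)=q^{\sum_{i<j}\lambda_{ji}a_ia_j}x_1^{a_1}\cdots x_N^{a_N}$. The quantum mutation in direction $i\in ex$ replaces $x_i$ by $x_i'=x(\sum_{b_{ki}>0}b_{ki}e_k-e_i)+x(\sum_{b_{ki}<0}-b_{ki}e_k-e_i)$,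 $\Lambda$ by $E^T\Lambda E$ and $B$ by $EBF$, where $E$ is the identity matrix except for column $i$, which has $e_{ii}=-1$, $e_{ai}=\max(0,-b_{ai})$ ($a\ne i$), and $F$ is the identity matrix (indexed by $ex$) except for row $i$, which has $f_{ii}=-1$, $f_{ib}=\max(0,b_{ib})$ ($b\ne i$). *)

(* Defs.v *)
From HB Require Import structures.
From mathcomp Require Import all_boot all_order all_fingroup all_algebra.

Set Implicit Arguments.
Unset Strict Implicit.
Unset Printing Implicit Defensive.

Import Order.TTheory GRing.Theory Num.Theory.
Local Open Scope ring_scope.

Definition K := {fraction {poly rat}}.
Definition q : K := tofrac ('X : {poly rat}).

Definition qmatrix_relations (m n : nat) (A : algType K)
    (Z : 'I_m -> 'I_n -> A) : Prop :=
  [/\ forall (i : 'I_m) (j k : 'I_n), (j < k)%N ->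
        Z i j * Z i k = q ^+ 2 *: (Z i k * Z i j),
      forall (i k : 'I_m) (j : 'I_n), (i < k)%N ->
        Z i j * Z k j = q ^+ 2 *: (Z k j * Z i j),
      forall (i s : 'I_m) (j t : 'I_n), (s < i)%N -> (j < t)%N ->
        Z i j * Z s t = Z s t * Z i j
    & forall (i s : 'I_m) (j t : 'I_n), (i < s)%N -> (j < t)%N ->
        Z i j * Z s t
          = Z s t * Z i j + (q ^+ 2 - q ^- 2) *: (Z i t * Z s j)].

(** [A] is the associative unital algebra presented by the generators [Z] and
    the relations above, expressed by the universal property of a
    presentation. *)
Definition is_qmatrix_algebra (m n : nat) (A : algType K)
    (Z : 'I_m -> 'I_n -> A) : Prop :=
  qmatrix_relations Z /\
  forall (B : algType K) (W : 'I_m -> 'I_n -> B), qmatrix_relations W ->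
    exists2 f : {lrmorphism A -> B},
      forall i j, f (Z i j) = W i j &
      forall g : {lrmorphism A -> B}, (forall i j, g (Z i j) = W i j) -> g =1 f.

Definition is_skew_field_of_fractions (A : algType K) (D : unitAlgType K)
    (iota : {lrmorphism A -> D}) : Prop :=
  [/\ forall x : D, x != 0 -> x \is a GRing.unit,
      injective iota
    & forall x : D, exists a b : A, b != 0 /\ x = iota a / iota b].

Definition inversions (r : nat) (s : 'S_r) : nat :=
  #|[set ij : 'I_r * 'I_r | (ij.1 < ij.2)%N && (s ij.2 < s ij.1)%N]|.

(** The index sets of a minor are given by their increasing enumerations
    [row] and [col].  The product is taken in the order of the rows. *)
Definition qminor (m n : nat) (A : algType K) (Z : 'I_m -> 'I_n -> A)
    (r : nat) (row : 'I_r -> 'I_m) (col : 'I_r -> 'I_n) : A :=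
  \sum_(s : 'S_r)
     (- q ^+ 2) ^+ inversions s *: \prod_(k < r) Z (row k) (col (s k)).

(** Points are 0-based: the pair [(i, j)] below is the point (i+1, j+1). *)

Notation point m n := ('I_m * 'I_n)%type.

Definition line_step (m n : nat) (x y : point m n) : bool :=
  ((y.1 == x.1 :> nat) && (y.2.+1 == x.2 :> nat)) ||
  ((y.1 == x.1.+1 :> nat) && (y.2 == x.2 :> nat)).

Definition broken_line (m n : nat) (L : {set point m n}) : Prop :=
  exists (x : point m n) (s : seq (point m n)),
    [/\ (x.1 = 0%N :> nat) /\ (x.2.+1 = n :> nat),
        ((last x s).1.+1 = m :> nat) /\ ((last x s).2 = 0%N :> nat),
        path (@line_step m n) x s
      & L = [set y in x :: s]].

(** [y] is [x + (t, t)] for some [t > 0], resp. some [t >= 0]. *)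
Definition diag_lt (m n : nat) (x y : point m n) : bool :=
  (x.1 < y.1)%N && (x.1 + y.2 == y.1 + x.2)%N.
Definition diag_le (m n : nat) (x y : point m n) : bool :=
  (x.1 <= y.1)%N && (x.1 + y.2 == y.1 + x.2)%N.

Definition above (m n : nat) (L : {set point m n}) : {set point m n} :=
  [set x : point m n | (x \notin L) && [exists y in L, diag_lt x y]].
Definition below (m n : nat) (L : {set point m n}) : {set point m n} :=
  [set x : point m n | (x \notin L) && [exists y in L, diag_lt y x]].

Definition line_le (m n : nat) (L1 L2 : {set point m n}) : bool :=
  above L2 \subset above L1.
Definition line_lt (m n : nat) (L1 L2 : {set point m n}) : bool :=
  line_le L1 L2 && (L1 != L2).

Definition closest_bigger (m n : nat) (L1 L2 : {set point m n}) : Prop :=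
  line_lt L1 L2 /\
  ~ exists L, [/\ broken_line L, line_lt L1 L & line_lt L L2].

Definition line_minus (m n : nat) : {set point m n} :=
  [set x : point m n | (x.2.+1 == n :> nat) || (x.1.+1 == m :> nat)].
Definition line_plus (m n : nat) : {set point m n} :=
  [set x : point m n | (x.1 == 0%N :> nat) || (x.2 == 0%N :> nat)].

(** The solid minor with upper left corner [a] and bottom right corner [b];
    meaningful when [diag_le a b], in which case the default values of
    [insubd] are not reached. *)
Definition solid_minor (m n : nat) (A : algType K) (Z : 'I_m -> 'I_n -> A)
    (a b : point m n) : A :=
  @qminor m n A Z (b.1 - a.1).+1
    (fun k => insubd a.1 (a.1 + k)%N) (fun k => insubd a.2 (a.2 + k)%N).

Definition box (m n : nat) (a b : point m n) : {set point m n} :=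
  [set x : point m n | (a.1 <= x.1 <= b.1)%N && (a.2 <= x.2 <= b.2)%N].

Definition line_variable (m n : nat) (A : algType K) (Z : 'I_m -> 'I_n -> A)
    (L : {set point m n}) (x : point m n) : A :=
  if x \in below L :|: L then
    solid_minor Z
      [arg max_(a > x | diag_le a x && (box a x \subset below L :|: L))
         (x.1 - a.1)%N] x
  else
    solid_minor Z x [arg max_(b > x | diag_le x b) (b.1 - x.1)%N].

Definition covariants (m n : nat) (A : algType K) (Z : 'I_m -> 'I_n -> A) :
    seq A :=
  [seq line_variable Z (line_plus m n) x | x in line_minus m n].

(** Columns of the B-matrix are labelled by [ex] through [enum_val]. *)
Record seed (D : unitAlgType K) (N : nat) (ex : {set 'I_N}) := Seed {
  var : {ffun 'I_N -> D};
  Lambda : 'M[int]_N;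
  Bmx : 'M[int]_(N, #|ex|)
}.

Definition is_Lambda_matrix (D : unitAlgType K) (N : nat)
    (x : 'I_N -> D) (La : 'M[int]_N) : Prop :=
  La^T = - La /\
  forall i j : 'I_N, x i * x j = q ^ (2 * La i j) *: (x j * x i).

Definition compatible_pair (N : nat) (ex : {set 'I_N})
    (La : 'M[int]_N) (B : 'M[int]_(N, #|ex|)) : Prop :=
  forall (j : 'I_#|ex|) (i : 'I_N),
    \sum_(k < N) B k j * La k i = 2 * (i == enum_val j)%:R.

Definition is_quantum_seed (D : unitAlgType K) (N : nat) (ex : {set 'I_N})
    (S : seed D ex) : Prop :=
  is_Lambda_matrix (var S) (Lambda S) /\ compatible_pair (Lambda S) (Bmx S).

Definition principal_part (N : nat) (ex : {set 'I_N})
    (B : 'M[int]_(N, #|ex|)) : 'M[int]_#|ex| :=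
  rowsub (fun j : 'I_#|ex| => enum_val j) B.

Definition monomial (D : unitAlgType K) (N : nat) (x : 'I_N -> D)
    (La : 'M[int]_N) (a : 'rV[int]_N) : D :=
  q ^ (\sum_(i < N) \sum_(j < N | (i < j)%N) La j i * a 0 i * a 0 j)
    *: \prod_(k < N) x k ^ a 0 k.

(** Mutation in direction [enum_val c]. *)
Definition mutation_E (N : nat) (ex : {set 'I_N}) (B : 'M[int]_(N, #|ex|))
    (c : 'I_#|ex|) : 'M[int]_N :=
  \matrix_(a, b) if b == enum_val c
                 then if a == b then -1 else Num.max 0 (- B a c)
                 else (a == b)%:R.

Definition mutation_F (N : nat) (ex : {set 'I_N}) (B : 'M[int]_(N, #|ex|))
    (c : 'I_#|ex|) : 'M[int]_#|ex| :=
  \matrix_(a, b) if a == c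
                 then if a == b then -1 else Num.max 0 (B (enum_val c) b)
                 else (a == b)%:R.

Definition mutated_variable (D : unitAlgType K) (N : nat) (ex : {set 'I_N})
    (S : seed D ex) (c : 'I_#|ex|) : D :=
  let i := enum_val c in
  let e (k : 'I_N) : 'rV[int]_N := delta_mx 0 k in
  monomial (var S) (Lambda S)
    ((\sum_(k < N | 0 < Bmx S k c) Bmx S k c *: e k) - e i) +
  monomial (var S) (Lambda S)
    ((\sum_(k < N | Bmx S k c < 0) (- Bmx S k c) *: e k) - e i).

Definition mutate (D : unitAlgType K) (N : nat) (ex : {set 'I_N})
    (S : seed D ex) (c : 'I_#|ex|) : seed D ex :=
  let E := mutation_E (Bmx S) c in
  let F := mutation_F (Bmx S) c in
  {| var := [ffun k => if k == enum_val c then mutated_variable S c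
                       else var S k];
     Lambda := E^T *m Lambda S *m E;
     Bmx := E *m Bmx S *m F |}.

Definition mutation_move (D : unitAlgType K) (N : nat) (ex : {set 'I_N})
    (S S' : seed D ex) : Prop :=
  exists c : 'I_#|ex|, S' = mutate S c.

Definition B_modification (D : unitAlgType K) (N : nat) (ex : {set 'I_N})
    (S S' : seed D ex) : Prop :=
  var S' = var S /\ Lambda S' = Lambda S.

(** A seed only depends on the set of its variables, so seeds are compared up
    to a relabelling [s] of the indices, which must match the mutable ones. *)
Definition same_seed (D : unitAlgType K) (N : nat) (ex ex' : {set 'I_N})
    (S : seed D ex) (S' : seed D ex') : Prop :=
  exists s : 'S_N,
    [/\ ex' = [set s i | i in ex],
        forall i, var S' (s i) = var S i,
        forall i j, Lambda S' (s i) (s j) = Lambda S i j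
      & forall (k : 'I_N) (c : 'I_#|ex|) (c' : 'I_#|ex'|),
          enum_val c' = s (enum_val c) -> Bmx S' (s k) c' = Bmx S k c].

(** The variables are numbered along the enumeration of the points. *)

Definition line_mutable (m n : nat) (A : algType K) (Z : 'I_m -> 'I_n -> A)
    (L : {set point m n}) : {set 'I_#|{: point m n}|} :=
  [set k | line_variable Z L (enum_val k) \notin covariants Z].

Definition line_quantum_seed (m n : nat) (A : algType K)
    (Z : 'I_m -> 'I_n -> A) (D : unitAlgType K) (iota : A -> D)
    (L : {set point m n}) (S : seed D (line_mutable Z L)) : Prop :=
  is_quantum_seed S /\
  forall k, var S k = iota (line_variable Z L (enum_val k)).

(* Main.v *)
Require Import Defs.
From HB Require Import structures.
From mathcomp Require Import all_boot all_order all_fingroup all_algebra.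
From mathcomp Require Import zify ring.

Set Implicit Arguments.
Unset Strict Implicit.
Unset Printing Implicit Defensive.

Import Order.TTheory GRing.Theory Num.Theory.
Local Open Scope ring_scope.

(** The lines L1 and L2 differ by the flip of one corner, so only the minors on
    one diagonal of the matrix change.  Let F_s be the solid minor of size s + 1
    whose upper left corner is the corner of L2, and G_s its translate by (1, 1).
    On this diagonal V_{L2} consists of F_0, ..., F_T and V_{L1} of
    G_0, ..., G_{T-1}, F_T.  The minors F_0, ..., F_{T-1} are mutated in this
    order into G_0, ..., G_{T-1}; the exchange relation is the quantum Dodgson
    identity
      q^2 G_t F_t = q^2 F_{t+1} G_{t-1} + P Q,
    where P and Q are the translates of F_t by (0, 1) and (1, 0).  As G_t commutes
    up to a power of q with every variable except F_t, the vector of exponents of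
    this relation is a legitimate column of the B-matrix, and it replaces the
    given one before the mutation.  The principal part of a matrix compatible with
    Lambda is determined by Lambda, so it is not affected. *)

(** * Quantum determinants *)

(** The replaced column has to pair to 2 with F_t and to 0 with every other variable. The value 2
    comes from F_t commuting with F_{t+1} G_{t-1} and picking up q^4 from P Q, one q^2 from each
    factor. For another variable x, the product G_t F_t commutes with x up to a power of q. Its two
    summands are linearly independent, since F_t commutes with them up to different scalars, so each
    of them commutes with x up to the same power, and the difference of their exponents pairs to 0
    with x.

    The q-commutation of G_t with the other variables has two sources. Most of them belong to
    V_{L1}, together with G_t, so the hypothesis that [Q1] is a quantum seed applies. The exceptions
    are the F_s with t < s < T: the entries of G_t lie in the matrix of F_s, and a quantum
    determinant commutes with the entries of its own matrix.

    The B-matrices of the two given seeds are arbitrary compatible ones. Hence one more replacement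
    is made after the last mutation, to install the matrix of [Q1]. *)

Lemma inversions_tperm (r : nat) (s : 'S_r) (k k1 : 'I_r) :
  k1 = k.+1 :> nat -> (s k < s k1)%N ->
  inversions (tperm k k1 * s)%g = (inversions s).+1.
Proof.
move=> kk1 lt_s; set t := tperm k k1.
(* [tt] matches the inversions of the two permutations, because exchanging the adjacent rows [k] and
   [k1] reverses the order of no other pair of rows. The pair (k, k1) is the one new inversion. *)
pose tt (x : 'I_r * 'I_r) := (t x.1, t x.2).
have ttI : injective tt by move=> [a b] [c d] [/perm_inj -> /perm_inj ->].
rewrite /inversions -[in RHS](card_preimset _ ttI).
rewrite [LHS](cardsD1 (k, k1)) inE !permM /= tpermL tpermR lt_s kk1 ltnSn /=.
rewrite add1n; congr _.+1; apply: eq_card => -[x y].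
rewrite !inE !permM /= xpair_eqE -/t.
case: (eqVneq x k) => [->|xk] /=.
  rewrite tpermL; case: (eqVneq y k1) => [->|yk1] /=.
    by rewrite tpermR; apply/esym/negbTE; rewrite negb_and -leqNgt; lia.
  case: (eqVneq y k) => [->|yk]; first by rewrite tpermL !ltnn.
  rewrite tpermD 1?eq_sym //; congr andb.
  by move: yk yk1; rewrite -!val_eqE /= => ? ?; apply/idP/idP; lia.
case: (eqVneq x k1) => [->|xk1] /=.
  rewrite tpermR; case: (eqVneq y k) => [->|yk] /=.
    by rewrite tpermL; apply/idP/idP; lia.
  case: (eqVneq y k1) => [->|yk1]; first by rewrite tpermR !ltnn.
  rewrite tpermD 1?eq_sym //; congr andb.
  by move: yk yk1; rewrite -!val_eqE /= => ? ?; apply/idP/idP; lia.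
rewrite [t x]tpermD 1?eq_sym //; congr andb.
case: tpermP => [->|->|//];
by move: xk xk1; rewrite -!val_eqE /= => ? ?; apply/idP/idP; lia.
Qed.

Lemma inversionsE (r : nat) (s : 'S_r) :
  inversions s = (\sum_(i < r) \sum_(j < r) ((i < j) && (s j < s i)))%N.
Proof.
by rewrite /inversions -sum1dep_card big_mkcond pair_bigA /=;
  apply: eq_bigr => -[i j] _ /=; case: ifP.
Qed.

(** The inserted point in row [i] and column [j] forms inversions with the later rows of smaller
    column and with the earlier rows of larger column. Lifting keeps the order of the other
    points. *)
Lemma inversions_lift_perm (r : nat) (i j : 'I_r.+1) (s : 'S_r) :
  inversions (lift_perm i j s) =
  (inversions s + \sum_(b < r) ((i <= b) && (s b < j))
                + \sum_(a < r) ((a < i) && (j <= s a)))%N.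
Proof.
rewrite !inversionsE (bigD1_ord i) //= (bigD1_ord i) //= ltnn add0n.
rewrite [X in (X + _)%N = _](_ : _ = \sum_(b < r) ((i <= b) && (s b < j)))%N;
  last first.
  apply: eq_bigr => b _; rewrite lift_perm_id lift_perm_lift /= /bump.
  by congr (nat_of_bool (_ && _)); apply/idP/idP; lia.
under eq_bigr => a _.
  rewrite (bigD1_ord i) //= lift_perm_id lift_perm_lift.
  under eq_bigr => b _ do rewrite lift_perm_lift.
  rewrite [X in (X + _)%N](_ : _ = nat_of_bool ((a < i) && (j <= s a))%N);
    last by rewrite /= /bump; congr (nat_of_bool (_ && _)); apply/idP/idP; lia.
  rewrite [X in (_ + X)%N](_ : _ = \sum_(b < r) ((a < b) && (s b < s a)))%N;
    last by apply: eq_bigr => b _; rewrite /= /bump;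
            congr (nat_of_bool (_ && _)); apply/idP/idP; lia.
  over.
by rewrite big_split /=; lia.
Qed.

Lemma sum_ltn_ord (r j : nat) : (j <= r)%N -> (\sum_(b < r) (b < j) = j)%N.
Proof.
move=> jr; rewrite -(big_mkord xpredT (fun b => nat_of_bool (b < j)%N)).
rewrite (big_cat_nat _ jr) //= [X in (_ + X)%N]big1_seq ?addn0; last first.
  by move=> b; rewrite mem_index_iota => /andP[_ /andP[jb _]]; rewrite ltnNge jb.
rewrite (eq_big_nat _ _ (F2 := fun=> 1%N)); last by move=> b /andP[_ ->].
by rewrite sum_nat_const_nat muln1 subn0.
Qed.

Lemma inversions_lift0 (r : nat) (j : 'I_r.+1) (s : 'S_r) :
  inversions (lift_perm ord0 j s) = (inversions s + j)%N.
Proof.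
rewrite inversions_lift_perm [X in (_ + X)%N]big1 // addn0; congr addn.
apply: etrans (sum_ltn_ord (leq_ord j)).
by rewrite [RHS](reindex_inj (@perm_inj _ s)).
Qed.

Lemma inversions_lift_max (r : nat) (j : 'I_r.+1) (s : 'S_r) :
  inversions (lift_perm ord_max j s) = (inversions s + (r - j))%N.
Proof.
rewrite inversions_lift_perm [X in (_ + X + _)%N]big1 ?addn0; last first.
  by move=> b _; rewrite leqNgt ltn_ord.
congr addn; have jr := leq_ord j.
have sum_lt := sum_ltn_ord jr; rewrite (reindex_inj (@perm_inj _ s)) /= in sum_lt.
have : (\sum_(a < r) ((s a < j) + (j <= s a)) = r)%N.
  rewrite -[RHS]card_ord -sum1_card; apply: eq_bigr => a _.
  by case: (ltnP (s a) j).
rewrite big_split /= sum_lt => sumE; rewrite -[X in (X - _)%N]sumE addKn.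
by apply: eq_bigr => a _; rewrite ltn_ord.
Qed.

Lemma inversions_lift_col0 (r : nat) (i : 'I_r.+1) (s : 'S_r) :
  inversions (lift_perm i ord0 s) = (inversions s + i)%N.
Proof.
rewrite inversions_lift_perm [X in (_ + X + _)%N]big1 ?addn0; last first.
  by move=> b _; rewrite ltn0 andbF.
congr addn; apply: etrans (sum_ltn_ord (leq_ord i)).
by apply: eq_bigr => a _; rewrite leq0n andbT.
Qed.

(** * Laplace expansions along extreme rows and columns, exchange of adjacent rows *)

Section QuantumDeterminants.

Variables (F : fieldType) (A : algType F) (p : F).
Implicit Types (U V : nat -> nat -> A) (r k : nat).

(* Matrices are indexed by [nat], so that shifting or deleting rows and columns
   needs no casts; only the entries below [r] matter. *)
Definition qdet r V : A :=
  \sum_(s : 'S_r) (- p) ^+ inversions s *: \prod_(k < r) V k (s k).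

Lemma eq_qdet r V V' :
  (forall a b, (a < r)%N -> (b < r)%N -> V a b = V' a b) -> qdet r V = qdet r V'.
Proof.
move=> eqV; apply: eq_bigr => s _; congr (_ *: _).
by apply: eq_bigr => k _; apply: eqV.
Qed.

Lemma qdet0 V : qdet 0 V = 1.
Proof.
have inv0 (s : 'S_0) : inversions s = 0%N by rewrite inversionsE big_ord0.
rewrite /qdet (eq_bigr (fun=> 1)); last first.
  by move=> s _; rewrite inv0 big_ord0 expr0 scale1r.
by rewrite sumr_const card_Sn fact0.
Qed.

(** A permutation is determined by the image of [i] and the permutation left after deleting it;
    surjectivity is a count of (r + 1)!. *)
Lemma sum_lift_perm r (i : 'I_r.+1) (f : 'S_r.+1 -> A) :
  \sum_s f s = \sum_(j < r.+1) \sum_(s : 'S_r) f (lift_perm i j s).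
Proof.
pose h (x : 'I_r.+1 * 'S_r) := lift_perm i x.1 x.2.
have h_inj : injective h.
  move=> [j1 s1] [j2 s2]; rewrite /h /= => eq_h.
  have j12 : j1 = j2 by rewrite -(lift_perm_id i j1 s1) eq_h lift_perm_id.
  move: eq_h; rewrite j12 => eq_h; congr pair; apply/permP => a.
  by apply: (@lift_inj _ j2); rewrite -!(lift_perm_lift i j2) eq_h.
have h_bij : bijective h.
  by apply: inj_card_bij => //; rewrite card_prod card_ord !card_Sn.
by rewrite pair_bigA (reindex h) //=; apply: onW_bij.
Qed.

Lemma qdet_row0 r V :
  qdet r.+1 V = \sum_(j < r.+1)
    (- p) ^+ j *: (V 0%N j * qdet r (fun a b => V a.+1 (bump j b))).
Proof.
rewrite /qdet (sum_lift_perm ord0); apply: eq_bigr => j _.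
rewrite mulr_sumr scaler_sumr; apply: eq_bigr => s _.
rewrite inversions_lift0 big_ord_recl lift_perm_id addnC exprD -scalerA.
rewrite -scalerAr; congr (_ *: (_ *: (_ * _))).
by apply: eq_bigr => k _; rewrite lift_perm_lift.
Qed.

Lemma qdet_row_last r V :
  qdet r.+1 V = \sum_(j < r.+1)
    (- p) ^+ (r - j) *: (qdet r (fun a b => V a (bump j b)) * V r j).
Proof.
rewrite /qdet (sum_lift_perm ord_max); apply: eq_bigr => j _.
rewrite mulr_suml scaler_sumr; apply: eq_bigr => s _.
rewrite inversions_lift_max big_ord_recr lift_perm_id addnC exprD -scalerA.
rewrite -scalerAl; congr (_ *: (_ *: (_ * _))).
apply: eq_bigr => k _.
have -> : widen_ord (leqnSn r) k = lift ord_max k.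
  by apply: val_inj; rewrite /= /bump leqNgt ltn_ord.
by rewrite lift_perm_lift /= /bump [(r <= k)%N]leqNgt ltn_ord.
Qed.

(** The products in [qdet] are ordered by rows. A column expansion needs the factor of row [i] in
    front, and this factor has to pass only those of the rows above it. *)
Lemma prod_lift_front r (i : 'I_r.+1) (G : 'I_r.+1 -> A) :
  (forall k : 'I_r, (k < i)%N -> GRing.comm (G (lift i k)) (G i)) ->
  \prod_k G k = G i * \prod_(k < r) G (lift i k).
Proof.
elim: r i G => [|r IH] i G commG.
  by rewrite big_ord_recl !big_ord0; congr (G _ * 1); apply: val_inj; rewrite [i]ord1.
rewrite [LHS]big_ord_recl; case: (unliftP ord0 i) commG => [i' ->|->] commG //.
rewrite (IH i' (fun a => G (lift ord0 a))) => [|k ki]; last first.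
  have -> : lift ord0 (lift i' k) = lift (lift ord0 i') (lift ord0 k).
    by apply: val_inj; rewrite /= /bump !add1n ltnS addnS.
  exact: (commG (lift ord0 k)).
rewrite [in RHS]big_ord_recl !mulrA.
have := commG ord0; rewrite lt0n => /(_ isT).
have -> : lift (lift ord0 i') ord0 = ord0 by apply: val_inj.
move=> ->; congr (_ * _); apply: eq_bigr => k _; congr G.
by apply: val_inj; rewrite /= /bump; lia.
Qed.

(** Summing over inverse permutations turns the splitting at row 0 into one by the row [i] that uses
    column 0. The entry of that row moves to the front past entries further up and to the right,
    with which it commutes. *)
Lemma qdet_col0 r V :
  (forall i s t, (s < i <= r)%N -> (t < r)%N ->
     GRing.comm (V s t.+1) (V i 0%N)) ->
  qdet r.+1 V = \sum_(i < r.+1)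
    (- p) ^+ i *: (V i 0%N * qdet r (fun a b => V (bump i a) b.+1)).
Proof.
move=> commV; rewrite /qdet (reindex_inj invg_inj) /= (sum_lift_perm ord0).
apply: eq_bigr => i _; rewrite mulr_sumr scaler_sumr.
rewrite (reindex_inj invg_inj) /=; apply: eq_bigr => s _.
rewrite -lift_permV invgK inversions_lift_col0 addnC exprD -scalerA.
rewrite -scalerAr; congr (_ *: (_ *: _)).
rewrite (@prod_lift_front _ i) => [|k ki]; last first.
  rewrite lift_perm_lift lift_perm_id; apply: commV => //=.
  by move: (ltn_ord i); rewrite /bump; lia.
rewrite lift_perm_id; congr (_ * _).
by apply: eq_bigr => k _; rewrite lift_perm_lift.
Qed.

(* The terms of [s] and of [s] composed with the transposition of rows [k] and
   [k.+1] pair up to a 2x2 quantum minor of these two rows. *)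
Lemma qdet_swap (c : F) r k V V' : (k.+1 < r)%N ->
  (forall a j, a != k -> a != k.+1 -> V' a j = V a j) ->
  (forall i j, (i < j < r)%N ->
     V k i * V k.+1 j - p *: (V k j * V k.+1 i) =
     c *: (V' k i * V' k.+1 j - p *: (V' k j * V' k.+1 i))) ->
  qdet r V = c *: qdet r V'.
Proof.
case: r => // r kr eqV' relV.
pose o k : 'I_r.+1 := inord k.
have oE a : (a < r.+1)%N -> o a = a :> nat by move=> ?; rewrite inordK.
pose l (W : nat -> nat -> A) (s : 'S_r.+1) := \prod_(0 <= a < k) W a (s (o a)).
pose h (W : nat -> nat -> A) (s : 'S_r.+1) := \prod_(k.+2 <= a < r.+1) W a (s (o a)).
have prodE (W : nat -> nat -> A) (s : 'S_r.+1) : \prod_(a < r.+1) W a (s a) =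
    l W s * (W k (s (o k)) * W k.+1 (s (o k.+1))) * h W s.
  rewrite (eq_bigr (fun a : 'I_r.+1 => W a (s (o a)))); last first.
    by move=> a _; rewrite /o inord_val.
  rewrite -(big_mkord xpredT (fun a => W a (s (o a)))).
  rewrite (big_cat_nat (n := k)) //=; last by lia.
  rewrite [X in _ * X]big_ltn; last by lia.
  by rewrite [X in _ * (_ * X)]big_ltn // !mulrA.
pose t := tperm (o k) (o k.+1).
have qdetE (W : nat -> nat -> A) : qdet r.+1 W =
   \sum_(s : 'S_r.+1 | (s (o k) < s (o k.+1))%N)
   (- p) ^+ inversions s *: (l W s *
      (W k (s (o k)) * W k.+1 (s (o k.+1)) -
       p *: (W k (s (o k.+1)) * W k.+1 (s (o k)))) * h W s).
  rewrite /qdet (bigID (fun s : 'S_r.+1 => (s (o k) < s (o k.+1))%N)) /=.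
  rewrite [X in _ + X](reindex_inj (mulgI t)) /=.
  rewrite [X in _ + X](eq_bigl (fun s : 'S_r.+1 => (s (o k) < s (o k.+1))%N));
    last first.
    move=> s; rewrite !permM tpermL tpermR -leqNgt leq_eqVlt.
    rewrite val_eqE (inj_eq perm_inj) -val_eqE /= !oE //; last by lia.
    by rewrite -(inj_eq succn_inj) /= ?(ltn_eqF (ltnSn _)) // eqn_leq ltnn.
  rewrite -big_split /=; apply: eq_bigr => s lt_s.
  rewrite !prodE inversions_tperm ?oE //; last by lia.
  rewrite !permM tpermL tpermR.
  have -> : l W (t * s)%g = l W s.
    apply: eq_big_nat => a /andP[_ ak]; rewrite permM tpermD // -val_eqE /= !oE;
      lia.
  have -> : h W (t * s)%g = h W s.
    apply: eq_big_nat => a /andP[ak ar]; rewrite permM tpermD // -val_eqE /= !oE;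
      lia.
  rewrite exprS mulNr scaleNr -scalerA mulrBr mulrBl scalerBr.
  by rewrite -scalerAr -scalerAl !scalerA mulrC.
rewrite !qdetE scaler_sumr; apply: eq_bigr => s lt_s.
rewrite relV ?lt_s ?ltn_ord //.
have -> : l V' s = l V s.
  by apply: eq_big_nat => a /andP[_ ak]; apply: eqV'; lia.
have -> : h V' s = h V s.
  by apply: eq_big_nat => a /andP[ak ar]; apply: eqV'; lia.
by rewrite -scalerAr -scalerAl !scalerA mulrC.
Qed.

End QuantumDeterminants.

(** * Alternation, centrality and the Dodgson identity *)

Definition increasing (r N : nat) (f : nat -> nat) : Prop :=
  (forall a, (a < r)%N -> (f a < N)%N) /\
  (forall a b, (a < b < r)%N -> (f a < f b)%N).

Lemma increasing_bump r i : increasing r r.+1 (bump i).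
Proof. by split=> a *; rewrite /bump; lia. Qed.

(** The list of rows [g] with [j] put in at position [k]. The result may be unordered or contain a
    repetition, and alternation is expressed by such lists. *)
Definition insert (k j : nat) (g : nat -> nat) (a : nat) : nat :=
  if (a < k)%N then g a else if a == k then j else g a.-1.

Section QuantumMatrices.

Variables (F : fieldType) (A : algType F) (p : F).
Hypothesis p_neq0 : p != 0.
Implicit Types (U V : nat -> nat -> A) (N r : nat).

Definition qmat N U : Prop :=
  [/\ forall i j t, (i < N)%N -> (j < t < N)%N ->
        U i j * U i t = p *: (U i t * U i j),
      forall i s j, (i < s < N)%N -> (j < N)%N ->
        U i j * U s j = p *: (U s j * U i j),
      forall i s j t, (s < i < N)%N -> (j < t < N)%N ->
        U i j * U s t = U s t * U i j
    & forall i s j t, (i < s < N)%N -> (j < t < N)%N ->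
        U i j * U s t = U s t * U i j + (p - p^-1) *: (U i t * U s j)].

Lemma qmat_sub N r U f g : increasing r N f -> increasing r N g ->
  qmat N U -> qmat r (fun a b => U (f a) (g b)).
Proof.
move=> [fN fI] [gN gI] [rowU colU antiU diagU].
split=> *; [apply: rowU | apply: colU | apply: antiU | apply: diagU];
  rewrite ?fN ?gN ?fI ?gI //=; lia.
Qed.

Lemma qmat_tr N U : qmat N U -> qmat N (fun a b => U b a).
Proof.
move=> [rowU colU antiU diagU]; split=> [||i s j t /andP[si iN] jt|i s j t is_ jt].
- by move=> *; apply: colU.
- by move=> *; apply: rowU.
- by rewrite [RHS]antiU // si.
- by rewrite diagU // (antiU t j i s).
Qed.

Lemma qmat_le M N U : (M <= N)%N -> qmat N U -> qmat M U.
Proof.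
by move=> MN; apply: (@qmat_sub N M U id id); split=> *; lia.
Qed.

(** On the left the larger row [j] comes just before [g k]. By the commutation relations of the
    entries, the 2x2 quantum minors of two rows in the wrong order are -p times those in the right
    order. *)
Lemma qdet_insert_lt N r U h k j g : qmat N U -> increasing r N h ->
  (k.+1 < r)%N -> (g k < j < N)%N ->
  qdet p r (fun a b => U (insert k j g a) (h b)) =
  - p *: qdet p r (fun a b => U (insert k.+1 j g a) (h b)).
Proof.
move=> [rowU colU antiU diagU] [hN hI] kr gj; apply: (@qdet_swap _ _ _ _ _ k) => //.
  move=> a b; rewrite /insert ltnS; case: ltngtP => // _ _ ak1.
  by rewrite (negbTE ak1).
move=> x y /andP[xy yr]; rewrite /insert ltnn eqxx ltnNge leqnSn /= ltnn.
rewrite gtn_eqF // ltnSn eqxx /=.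
have hxy : (h x < h y < N)%N by rewrite hI ?xy // hN.
rewrite antiU // (diagU (g k) j (h x) (h y) gj hxy).
rewrite scalerBl addrA [in RHS]addrAC addrK scalerBr scalerA mulNr mulfV //.
by rewrite scaleN1r opprK addrC scaleNr.
Qed.

Lemma qdet_insert_gt N r U h k j g : qmat N U -> increasing r N h ->
  (k.+1 < r)%N -> (j < g k < N)%N ->
  qdet p r (fun a b => U (insert k.+1 j g a) (h b)) =
  - p *: qdet p r (fun a b => U (insert k j g a) (h b)).
Proof.
move=> qU hU kr gj.
(* In the list [g'], where [j] replaces [g k], it is the larger row [g k] that gets inserted, so the
   preceding rule applies. *)
pose g' a := if a == k then j else g a.
transitivity (qdet p r (fun a b => U (insert k (g k) g' a) (h b))).
  apply: eq_qdet => a b _ _; congr (U _ _); rewrite /insert /g' ltnS.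
  case: ltngtP => [ak|ka|ak]; rewrite ?ak ?eqxx //.
  by case: (eqVneq a k.+1) => [->|ak]; rewrite /= ?eqxx // gtn_eqF //; lia.
rewrite (qdet_insert_lt qU hU) // /g' ?eqxx //; congr (_ *: _).
apply: eq_qdet => a b _ _; congr (U _ _); rewrite /insert ltnS.
case: ltngtP => [ak|ka|ak]; rewrite ?ak ?eqxx //.
by case: (eqVneq a k.+1) => [->|ak]; rewrite //= gtn_eqF //; lia.
Qed.

Lemma qdet_insert_eq N r U h k g : qmat N U -> increasing r N h ->
  (k.+1 < r)%N -> (g k < N)%N ->
  qdet p r (fun a b => U (insert k (g k) g a) (h b)) = 0.
Proof.
move=> [rowU _ _ _] [hN hI] kr gN; rewrite -[RHS](scale0r (qdet p r U)).
pose V a b := U (insert k (g k) g a) (h b).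
(* The 2x2 quantum minors of a repeated row vanish by the row relation, so the rows may be exchanged
   with the scalar 0, [V] itself being the second matrix. *)
rewrite (@qdet_swap _ _ _ 0 r k V V) ?scale0r //.
move=> x y /andP[xy yr]; rewrite scale0r /V /insert ltnn eqxx ltnNge leqnSn /=.
by rewrite gtn_eqF // rowU ?hI ?hN ?xy ?subrr.
Qed.

Lemma qdet_insert_front N r U h k j g : qmat N U -> increasing r N h ->
  (k < r)%N -> (j < N)%N -> (forall a, (a < k)%N -> (g a < j)%N) ->
  qdet p r (fun a b => U (insert 0 j g a) (h b)) =
  (- p) ^+ k *: qdet p r (fun a b => U (insert k j g a) (h b)).
Proof.
move=> qU hU; elim: k => [|k IH] kr jN gj; first by rewrite expr0 scale1r.
rewrite IH //; [|lia|by move=> a ak; apply: gj; lia].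
by rewrite (qdet_insert_lt qU hU) ?gj // scalerA exprSr.
Qed.

Lemma qdet_insert_last N r U h k j g : qmat N U -> increasing r.+1 N h ->
  (k <= r)%N -> (forall a, (k <= a < r)%N -> (j < g a < N)%N) ->
  qdet p r.+1 (fun a b => U (insert r j g a) (h b)) =
  (- p) ^+ (r - k) *: qdet p r.+1 (fun a b => U (insert k j g a) (h b)).
Proof.
move=> qU hU kr; rewrite -{1 3}(subnKC kr); move: (r - k)%N (subnKC kr) => d.
elim: d k {kr} => [|d IH] k kdr gj; first by rewrite addn0 expr0 scale1r.
rewrite addnS -addSn IH; [|lia|by move=> a ar; apply: gj; lia].
by rewrite (qdet_insert_gt qU hU) ?gj ?scalerA ?exprSr //; lia.
Qed.

(** The sum is the determinant with row [i] on top of all rows except row [k]. For i = k, sorting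
    the rows costs (-p)^k; otherwise row [i] occurs twice. *)
Lemma qdet_row_expansion r U i k : qmat r.+1 U -> (i <= r)%N -> (k <= r)%N ->
  \sum_(j < r.+1) (- p) ^+ j *:
     (U i j * qdet p r (fun a b => U (bump k a) (bump j b))) =
  if i == k then (- p) ^+ k *: qdet p r.+1 U else 0.
Proof.
move=> qU ir kr; have idI : increasing r.+1 r.+1 id by split=> *; lia.
transitivity (qdet p r.+1 (fun a b => U (insert 0 i (bump k) a) b)).
  by rewrite qdet_row0.
case: eqVneq => [->|ik].
  rewrite (qdet_insert_front qU idI (k := k)) //; last first.
    by move=> a ak; rewrite /bump; lia.
  congr (_ *: _); apply: eq_qdet => a b _ _; congr (U _ _).
  by rewrite /insert /bump; case: ltngtP; lia.
(* [l] is the position of row [i] among the rows other than [k]; the copy on top is moved down to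
   it. *)
pose l := unbump k i; have li : bump k l = i by rewrite /l unbumpK ?inE.
have lr : (l.+1 < r.+1)%N by rewrite /l /unbump; lia.
rewrite (qdet_insert_front qU idI (k := l)) //; [|lia|]; last first.
  by move=> a al; rewrite -li /bump; lia.
by rewrite -li (qdet_insert_eq qU idI) ?scaler0 ?li.
Qed.

(** The mirror image: row [i] is appended below the rows other than [k] and moved up. *)
Lemma qdet_row_expansion_right r U i k :
  qmat r.+1 U -> (i <= r)%N -> (k <= r)%N ->
  \sum_(j < r.+1) (- p) ^+ (r - j) *:
     (qdet p r (fun a b => U (bump k a) (bump j b)) * U i j) =
  if i == k then (- p) ^+ (r - k) *: qdet p r.+1 U else 0.
Proof.
move=> qU ir kr; have idI : increasing r.+1 r.+1 id by split=> *; lia.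
transitivity (qdet p r.+1 (fun a b => U (insert r i (bump k) a) b)).
  rewrite qdet_row_last; apply: eq_bigr => j _; congr (_ *: (_ * _)).
    by apply: eq_qdet => a b ar _; rewrite /insert ar.
  by rewrite /insert ltnn eqxx.
case: eqVneq => [->|ik].
  rewrite (qdet_insert_last qU idI (k := k)) //; last first.
    by move=> a ak; rewrite /bump; lia.
  congr (_ *: _); apply: eq_qdet => a b _ _; congr (U _ _).
  by rewrite /insert /bump; case: ltngtP; lia.
pose l := unbump k i; have li : bump k l = i by rewrite /l unbumpK ?inE.
have lr : (l.+1 < r.+1)%N by rewrite /l /unbump; lia.
rewrite (qdet_insert_last qU idI (k := l.+1)) //; last first.
  by move=> a al; rewrite -li /bump; lia.
(* Inserting row [i] before or after its copy gives the same list. *)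
rewrite -[X in _ *: X](_ : qdet p r.+1 (fun a b => U (insert l i (bump k) a) b) = _).
  by rewrite -li (qdet_insert_eq qU idI) ?scaler0 ?li.
apply: eq_qdet => a b _ _; congr (U _ _); rewrite /insert ltnS.
case: ltngtP => // [la|->]; last by rewrite li.
by case: (eqVneq a l.+1) => [->|].
Qed.

(** Expansion of the transpose along row 0 agrees term by term with expansion of [U] along column 0,
    by induction on the minors. *)
Lemma qdet_tr r U : qmat r U -> qdet p r (fun a b => U b a) = qdet p r U.
Proof.
elim: r U => [|r IH] U qU; first by rewrite !qdet0.
rewrite qdet_row0 qdet_col0 => [|i s t si tr]; last first.
  by case: qU => _ _ antiU _; apply/esym/antiU; lia.
apply: eq_bigr => i _; congr (_ *: (_ * _)).
apply: (IH (fun a b => U (bump i a) b.+1)).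
by apply: (qmat_sub (g := succn) (increasing_bump r i)) qU; split=> *; lia.
Qed.

Lemma qdet_col_expansion_right r U j k :
  qmat r.+1 U -> (j <= r)%N -> (k <= r)%N ->
  \sum_(i < r.+1) (- p) ^+ (r - i) *:
     (qdet p r (fun a b => U (bump i a) (bump k b)) * U i j) =
  if j == k then (- p) ^+ (r - k) *: qdet p r.+1 U else 0.
Proof.
move=> qU jr kr; rewrite -(qdet_tr qU) -(qdet_row_expansion_right (qmat_tr qU)) //.
apply: eq_bigr => i _; congr (_ *: (_ * _)); apply/esym.
apply: (@qdet_tr r (fun a b => U (bump i a) (bump k b))).
by apply: qmat_sub qU; apply: increasing_bump.
Qed.

Lemma comm_qdet r V (x : A) :
  (forall a b, (a < r)%N -> (b < r)%N -> GRing.comm x (V a b)) ->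
  GRing.comm x (qdet p r V).
Proof.
move=> commx; apply: commr_sum => s _; rewrite /GRing.comm -scalerAr -scalerAl.
by congr (_ *: _); apply: commr_prod => k _; apply: commx.
Qed.

(* [U * adj U * U] is evaluated in both orders. *)
Lemma qdet_central r U i j : qmat r U -> (i < r)%N -> (j < r)%N ->
  GRing.comm (qdet p r U) (U i j).
Proof.
case: r => // r qU ir jr; pose D := qdet p r.+1 U.
pose X k l := qdet p r (fun a b => U (bump k a) (bump l b)).
pose S := \sum_(k < r.+1) \sum_(l < r.+1)
  (- p) ^+ l *: ((- p) ^+ (r - k) *: (U i l * X k l * U k j)).
have S1 : S = (- p) ^+ r *: (D * U i j).
  rewrite /S (bigD1 (Ordinal ir)) //= [X in _ + X]big1 => [|k ki]; last first.
    have := qdet_row_expansion qU ir (leq_ord k); rewrite ifN; last first.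
      by rewrite eq_sym.
    move=> /(congr1 (fun x => (- p) ^+ (r - k) *: (x * U k j))).
    rewrite mul0r scaler0 mulr_suml scaler_sumr => sum0; apply: etrans sum0.
    by apply: eq_bigr => l _; rewrite scalerA mulrC -scalerA scalerAl.
  have := qdet_row_expansion qU ir ir; rewrite eqxx.
  move=> /(congr1 (fun x => (- p) ^+ (r - i) *: (x * U i j))).
  rewrite mulr_suml scaler_sumr -scalerAl scalerA -exprD subnK // addr0 => <-.
  by apply: eq_bigr => l _; rewrite scalerA mulrC -scalerA scalerAl.
have S2 : S = (- p) ^+ r *: (U i j * D).
  rewrite /S exchange_big (bigD1 (Ordinal jr)) //= [X in _ + X]big1 => [|l lj];
    last first.
    have := qdet_col_expansion_right qU jr (leq_ord l); rewrite ifN; last first.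
      by rewrite eq_sym.
    move=> /(congr1 (fun x => (- p) ^+ l *: (U i l * x))).
    rewrite mulr0 scaler0 mulr_sumr scaler_sumr => sum0; apply: etrans sum0.
    by apply: eq_bigr => k _; rewrite -scalerAr mulrA.
  have := qdet_col_expansion_right qU jr jr; rewrite eqxx.
  move=> /(congr1 (fun x => (- p) ^+ j *: (U i j * x))).
  rewrite mulr_sumr scaler_sumr -scalerAr scalerA -exprD subnKC // addr0 => <-.
  by apply: eq_bigr => k _; rewrite -scalerAr mulrA.
have pr : (- p) ^+ r != 0 by rewrite expf_neq0 ?oppr_eq0.
by apply: (scalerI pr); rewrite -S1 S2.
Qed.

(* The sum [S] pairs the first column of the adjugate with the determinants
   whose first row is row [i] of [U]: expanding these along that row leaves only
   [D * M], while only [i = 0] and [i = r.+1] survive by alternation. *)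
Lemma quantum_dodgson r U : qmat r.+2 U ->
  p *: (qdet p r.+1 (fun a b => U a.+1 b.+1) * qdet p r.+1 U) =
  p *: (qdet p r.+2 U * qdet p r (fun a b => U a.+1 b.+1)) +
  qdet p r.+1 (fun a b => U a b.+1) * qdet p r.+1 (fun a b => U a.+1 b).
Proof.
move=> qU; set M := qdet p r _; set D := qdet p r.+2 U.
pose X i := qdet p r.+1 (fun a b => U (bump i a) b.+1).
pose Y i := qdet p r.+1 (fun a b => U (insert 0 i succn a) b).
have idI : increasing r.+1 r.+2 id by split=> *; lia.
pose S := \sum_(i < r.+2) (- p) ^+ (r.+1 - i) *: (X i * Y i).
have S1 : S = (- p) ^+ r.+1 *: (D * M).
  pose N l := qdet p r (fun a b => U a.+1 (bump l b)).
  transitivity (\sum_(l < r.+1) (- p) ^+ l *: (\sum_(i < r.+2)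
      (- p) ^+ (r.+1 - i) *: (X i * U i l) * N l)).
    under [RHS]eq_bigr do rewrite scaler_sumr.
    rewrite exchange_big; apply: eq_bigr => i _.
    rewrite /Y qdet_row0 mulr_sumr scaler_sumr; apply: eq_bigr => l _.
    by rewrite -scalerAr mulrA -scalerAl !scalerA mulrC.
  have colE l : (l <= r.+1)%N ->
      \sum_(i < r.+2) (- p) ^+ (r.+1 - i) *: (X i * U i l) =
      if l == 0%N then (- p) ^+ r.+1 *: D else 0.
    by move=> lr; rewrite (qdet_col_expansion_right qU lr (leq0n _)) subn0.
  rewrite big_ord_recl -mulr_suml colE // expr0 scale1r -scalerAl big1 ?addr0 //.
  move=> l _; rewrite -mulr_suml colE /= ?mul0r ?scaler0 //.
  by have := ltn_ord l; rewrite /bump; lia.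
have S2 : S = (- p) ^+ r.+1 *: (X 0%N * qdet p r.+1 U) +
              (- p) ^+ r *: (X r.+1 * qdet p r.+1 (fun a b => U a.+1 b)).
  rewrite /S big_ord_recl big_ord_recr big1 => [|i _]; last first.
    have ir := ltn_ord i; rewrite /Y /= /bump leq0n add1n.
    rewrite (qdet_insert_front (k := i) qU idI) //; [|lia..].
    rewrite (qdet_insert_eq (k := i) (g := succn) qU idI) //; last by lia.
    by rewrite scaler0 mulr0 scaler0.
  rewrite [X in _ + X]add0r subn0; congr (_ *: (_ * _) + _).
    by apply: eq_qdet => -[].
  rewrite /= /bump leq0n add1n subnn expr0 scale1r /Y scalerAr; congr (_ * _).
  rewrite (qdet_insert_front qU idI (k := r)) //; congr (_ *: _).
  by apply: eq_qdet => a b ar _; congr (U _ _); rewrite /insert; case: ltngtP; lia.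
have pr : (- p) ^+ r != 0 by rewrite expf_neq0 ?oppr_eq0.
apply: (scalerI pr); have := etrans (esym S1) S2; rewrite !exprSr.
rewrite -!scalerA -scalerDr => /(scalerI pr); rewrite !scaleNr => SE.
rewrite -/(X r.+1) in SE *.
rewrite (_ : X r.+1 = qdet p r.+1 (fun a b => U a b.+1)) in SE; last first.
  by apply: eq_qdet => a b ar _; rewrite /bump leqNgt ar.
by rewrite -[p *: (D * M)]opprK SE opprD opprK addrNK.
Qed.

(** Passing to the transpose exchanges the two factors of the last term of the Dodgson identity and
    fixes every other determinant in it. *)
Lemma qdet_off_diagonal_comm r U : qmat r.+2 U ->
  GRing.comm (qdet p r.+1 (fun a b => U a b.+1))
             (qdet p r.+1 (fun a b => U a.+1 b)).
Proof.
move=> qU; have shiftU f g : increasing r.+1 r.+2 f -> increasing r.+1 r.+2 g ->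
    qmat r.+1 (fun a b => U (f a) (g b)) by move=> *; apply: (@qmat_sub r.+2).
have idI : increasing r.+1 r.+2 id by split=> *; lia.
have SI : increasing r.+1 r.+2 succn by split=> *; lia.
have := quantum_dodgson (qmat_tr qU); rewrite (qdet_tr qU).
rewrite (qdet_tr (shiftU _ _ SI SI)) (qdet_tr (shiftU _ _ idI idI)).
rewrite (qdet_tr (shiftU _ _ SI idI)) (qdet_tr (shiftU _ _ idI SI)).
rewrite (@qdet_tr r (fun a b => U a.+1 b.+1)); last first.
  by apply: (@qmat_sub r.+2 r U succn succn) => //; split=> *; lia.
by rewrite (quantum_dodgson qU) => /addrI.
Qed.

(* With [B] the last column of the adjugate, [z * B j] and [B j * z] are compared
   after multiplication by [U], which is left cancellable. *)
Lemma qdet_comm_last_col r U a : qmat r.+1 U ->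
  (forall x, qdet p r.+1 U * x = 0 -> x = 0) -> (a < r)%N ->
  qdet p r U * U a r = p *: (U a r * qdet p r U).
Proof.
move=> qU regD ar; set D := qdet p r.+1 U in regD; set z := U a r.
have [rowU colU antiU diagU] := qU.
have [B BE] : exists B, forall j,
    B j = (- p) ^+ j *: qdet p r (fun a b => U (bump r a) (bump j b)).
  by eexists.
have Br : B r = (- p) ^+ r *: qdet p r U.
  rewrite BE; congr (_ *: _); apply: eq_qdet => x y xr yr.
  by rewrite /bump [(r <= x)%N]leqNgt [(r <= y)%N]leqNgt xr yr.
pose s i := \sum_(j < r) U i j * B j.
have rowE i : (i <= r)%N ->
    s i + U i r * B r = if i == r then (- p) ^+ r *: D else 0.
  move=> ir; rewrite -(qdet_row_expansion qU ir (leqnn r)) big_ord_recr /=.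
  by rewrite /s; congr (_ + _); [apply: eq_bigr => j _|];
    rewrite BE -scalerAr.
have zD : z * D = D * z by apply/esym/qdet_central => //; lia.
(* Row [i] of [U] applied to z * B equals z times row [i] applied to [B], up to a correction. The
   correction has the same shape for [i] above, below or equal to [a], which makes a uniform [W]
   possible. *)
have zrow i : (i <= r)%N -> \sum_(j < r) U i j * (z * B j) + U i r * (z * B r) =
    z * (s i + U i r * B r) + (1 - p) *: (U i r * (z * B r)).
  move=> ir; rewrite mulrDr /s mulr_sumr; case: (ltngtP i a) => [ia|ai|->].
  - have colz : U i r * z = p *: (z * U i r) by apply: colU; lia.
    rewrite (eq_bigr (fun j : 'I_r => z * (U i j * B j) +
        (p - p^-1) *: (U i r * (U a j * B j)))) => [|j _]; last first.
      rewrite !mulrA (diagU i a j r) //; [|lia|have := ltn_ord j; lia].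
      by rewrite mulrDl -scalerAl.
    rewrite big_split /= -addrA -[RHS]addrA; congr (_ + _).
    rewrite -scaler_sumr -mulr_sumr; have := rowE a (ltnW ar).
    rewrite ltn_eqF // => /(canRL (addrK _)); rewrite sub0r /s => ->.
    rewrite mulrN !mulrA -/z colz -!scalerAl scalerN !scalerA -scaleNr.
    rewrite -[X in _ = X + _]scale1r -!scalerDl; congr (_ *: _).
    by rewrite !mulrBl mulVf //; ring.
  - have colz : z * U i r = p *: (U i r * z) by apply: colU; lia.
    rewrite (eq_bigr (fun j : 'I_r => z * (U i j * B j))) => [|j _]; last first.
      by rewrite !mulrA (antiU i a j r) //; have := ltn_ord j; lia.
    rewrite -addrA; congr (_ + _).
    by rewrite !mulrA colz -scalerAl -scalerDl addrC subrK scale1r.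
  - rewrite (eq_bigr (fun j : 'I_r => p *: (z * (U a j * B j)))) => [|j _];
      last first.
      by rewrite !mulrA (rowU a j r) ?scalerAl //; have := ltn_ord j; lia.
    rewrite -scaler_sumr -mulr_sumr -/(s a) -mulrDr (rowE a) ?ltn_eqF //; last lia.
    have := rowE a (ltnW ar); rewrite ltn_eqF // => /(canRL (addrK _)) ->.
    by rewrite sub0r mulrN scalerN mulr0 add0r scalerBl scale1r addrC.
(* Correcting only the last coordinate makes [U] annihilate [W]: each coordinate of U * B is zero or
   a scalar multiple of [D], which commutes with [z]. *)
pose W j := z * B j - B j * z - (if j == r then (1 - p) *: (z * B r) else 0).
have UW i : (i <= r)%N -> \sum_(j < r.+1) U i j * W j = 0.
  move=> ir; rewrite big_ord_recr /=.
  rewrite (eq_bigr (fun j : 'I_r => U i j * (z * B j) - U i j * B j * z));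
    last first.
    by move=> j _; rewrite /W (ltn_eqF (ltn_ord j)) subr0 mulrBr -[in RHS]mulrA.
  rewrite sumrB -mulr_suml -/(s i) /W eqxx !mulrBr -scalerAr.
  rewrite [U i r * (B r * z)]mulrA !addrA [X in X - _ - _]addrAC zrow //.
  rewrite -[_ - s i * z - _]addrA -opprD -mulrDl addrAC addrK rowE //.
  case: eqP => _; last by rewrite mulr0 mul0r subrr.
  by rewrite -scalerAr -scalerAl zD subrr.
(* The signed minors that omit the last column, multiplied on the left of [U], give [D] in the last
   column and 0 elsewhere; applied to U * W = 0 they isolate [W r]. *)
have : D * W r = 0.
  have colE j : (j <= r)%N -> \sum_(i < r.+1) (- p) ^+ (r - i) *:
     (qdet p r (fun a b => U (bump i a) (bump r b)) * U i j) =
     if j == r then D else 0.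
    by move=> jr; rewrite qdet_col_expansion_right // subnn expr0 scale1r.
  transitivity (\sum_(j < r.+1) (if j == r :> nat then D else 0) * W j).
    rewrite big_ord_recr /= eqxx big1 ?add0r // => j _.
    by rewrite (ltn_eqF (ltn_ord j)) mul0r.
  under eq_bigr => j _ do rewrite -(colE j (leq_ord j)) mulr_suml.
  rewrite exchange_big big1 //= => i _.
  under eq_bigr do rewrite -scalerAl -mulrA.
  by rewrite -scaler_sumr -mulr_sumr UW ?leq_ord // mulr0 scaler0.
move=> /regD; rewrite /W eqxx scalerBl scale1r opprB addrC addrA subrK => /eqP.
rewrite subr_eq0 Br -!scalerAr -scalerAl scalerA mulrC -scalerA.
by move=> /eqP /(scalerI _) <- //; rewrite expf_neq0 ?oppr_eq0.
Qed.

(** Every term of the determinant uses each column exactly once, so the same product of scalars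
    appears whatever the permutation. *)
Lemma scaled_comm_qdet r V (c : nat -> F) (x : A) :
  (forall a b, (a < r)%N -> (b < r)%N -> x * V a b = c b *: (V a b * x)) ->
  x * qdet p r V = (\prod_(b < r) c b) *: (qdet p r V * x).
Proof.
move=> commx; rewrite mulr_sumr mulr_suml scaler_sumr; apply: eq_bigr => s _.
rewrite -scalerAr -scalerAl !scalerA mulrC -scalerA; congr (_ *: _).
rewrite (reindex_inj (@perm_inj _ s)) /=.
have {}commx (k : 'I_r) : x * V k (s k) = c (s k) *: (V k (s k) * x).
  exact: commx.
elim/big_rec2: _ => [|k y d _ IH]; first by rewrite mulr1 mul1r scale1r.
by rewrite mulrA commx -scalerAl -mulrA IH -scalerAr scalerA mulrA.
Qed.

(** All columns of the shifted matrix but the last belong to the matrix of [qdet p r.+1 U], which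
    commutes with its own entries. The last column contributes the single factor [p]. *)
Lemma qdet_comm_shift_col r U : qmat r.+2 U ->
  (forall x, qdet p r.+2 U * x = 0 -> x = 0) ->
  qdet p r.+1 U * qdet p r.+1 (fun a b => U a b.+1) =
  p *: (qdet p r.+1 (fun a b => U a b.+1) * qdet p r.+1 U).
Proof.
move=> qU regD; pose c b := if b == r then p else 1.
rewrite (@scaled_comm_qdet _ _ c) => [|a b ar]; last first.
  rewrite ltnS leq_eqVlt /c => /predU1P[->|br].
    by rewrite eqxx; apply: qdet_comm_last_col.
  rewrite ltn_eqF // scale1r; apply: qdet_central => //.
  by apply: qmat_le qU.
rewrite big_ord_recr /= /c eqxx big1 ?mul1r // => i _.
by rewrite (ltn_eqF (ltn_ord i)).
Qed.

Lemma qdet_comm_shift_row r U : qmat r.+2 U ->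
  (forall x, qdet p r.+2 U * x = 0 -> x = 0) ->
  qdet p r.+1 U * qdet p r.+1 (fun a b => U a.+1 b) =
  p *: (qdet p r.+1 (fun a b => U a.+1 b) * qdet p r.+1 U).
Proof.
move=> qU regD; have := qdet_comm_shift_col (qmat_tr qU).
rewrite (qdet_tr qU) => /(_ regD).
rewrite (qdet_tr (qmat_le (leqnSn _) qU)).
rewrite (@qdet_tr r.+1 (fun a b => U a.+1 b)) //.
by apply: (@qmat_sub r.+2 r.+1 U succn id) => //; split=> *; lia.
Qed.

End QuantumMatrices.

(** * Quantum seeds *)

Lemma q_neq0 : q != 0.
Proof. by rewrite tofrac_eq0 polyX_eq0. Qed.

Lemma q_expz_eq1 (a : int) : q ^ a = 1 -> a = 0.
Proof.
have q_expn n : q ^+ n = 1 -> n = 0%N.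
  move=> /eqP; rewrite /q -tofracXn -tofrac1 tofrac_eq => /eqP.
  move=> /(congr1 (fun s : {poly rat} => size s)).
  by rewrite size_polyXn size_poly1; case.
case: a => n; first by rewrite -exprnP => /q_expn ->.
by rewrite NegzE -exprnN => /(canRL invrK); rewrite invr1 => /q_expn.
Qed.

Lemma q_expz_inj : injective (fun a : int => q ^ a).
Proof.
move=> a b /= qab; apply/eqP; rewrite -subr_eq0; apply/eqP/q_expz_eq1.
by rewrite expfzDr ?q_neq0 // qab -expfzDr ?q_neq0 // subrr.
Qed.

(** * Commutation up to a scalar, for products and integer powers *)

Section QCommutation.

Variables (F : fieldType) (D : unitAlgType F).
Implicit Types (c d : F) (x y z : D).

Definition qcomm c x y : Prop := x * y = c *: (y * x).

Lemma qcommMl c d x y z : qcomm c x z -> qcomm d y z -> qcomm (c * d) (x * y) z.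
Proof.
rewrite /qcomm => xz yz.
by rewrite -mulrA yz -scalerAr [x * (z * y)]mulrA xz -scalerAl scalerA [d * c]mulrC mulrA.
Qed.

Lemma qcomm_sym c x y : c != 0 -> qcomm c x y -> qcomm c^-1 y x.
Proof. by rewrite /qcomm => c0 ->; rewrite scalerA mulVf // scale1r. Qed.

Lemma qcommVl c x y : c != 0 -> x \is a GRing.unit ->
  qcomm c x y -> qcomm c^-1 x^-1 y.
Proof.
rewrite /qcomm => c0 ux xy; apply: (mulrI ux).
rewrite mulrA mulrV // mul1r -scalerAr !mulrA xy -scalerAl scalerA mulVf //.
by rewrite scale1r mulrK.
Qed.

Lemma qcommXl c x y n : qcomm c x y -> qcomm (c ^+ n) (x ^+ n) y.
Proof.
move=> xy; elim: n => [|n IH]; first by rewrite /qcomm mul1r mulr1 scale1r.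
by rewrite !exprS; apply: qcommMl.
Qed.

Lemma qcommXzl c x y (a : int) : c != 0 -> x \is a GRing.unit ->
  qcomm c x y -> qcomm (c ^ a) (x ^ a) y.
Proof.
move=> c0 ux xy; case: a => n; first exact: qcommXl.
rewrite NegzE -!exprnN; apply: qcommVl; first by rewrite expf_neq0.
  by rewrite unitrX.
exact: qcommXl.
Qed.

Lemma qcommXz c x y (a b : int) :
  c != 0 -> x \is a GRing.unit -> y \is a GRing.unit ->
  qcomm c x y -> qcomm (c ^ (a * b)) (x ^ a) (y ^ b).
Proof.
move=> c0 ux uy /(qcommXzl a c0 ux) xy.
have ca0 : c ^ a != 0 by rewrite expfz_neq0.
have := qcommXzl b _ uy (qcomm_sym ca0 xy); rewrite invr_eq0 => /(_ ca0) yx.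
have := qcomm_sym _ yx; rewrite expfz_neq0 ?invr_eq0 // => /(_ isT).
by rewrite exprz_inv invr_expz opprK exprz_exp.
Qed.

End QCommutation.

(** * Normalised monomials and the skew form of Lambda *)

Section Monomials.

Variables (D : unitAlgType K) (N : nat) (x : 'I_N -> D) (La : 'M[int]_N).
Hypotheses (xU : forall i, x i \is a GRing.unit) (xLa : is_Lambda_matrix x La).
Implicit Types (a b : 'rV[int]_N).

(** Twice this value is the exponent of q by which the monomials with exponents [a] and [b]
    commute. *)
Definition Lform a b : int := (a *m La *m b^T) 0 0.

Lemma LformDl a1 a2 b : Lform (a1 + a2) b = Lform a1 b + Lform a2 b.
Proof. by rewrite /Lform !mulmxDl mxE. Qed.

Lemma LformNl a b : Lform (- a) b = - Lform a b.
Proof. by rewrite /Lform !mulNmx mxE. Qed.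

Lemma Lform_sym a b : Lform a b = - Lform b a.
Proof.
have := congr1 (fun M => (b *m M *m a^T) 0 0) (proj1 xLa).
rewrite mulmxN mulNmx [RHS]mxE /Lform => <-.
have -> : b *m La^T *m a^T = (a *m La *m b^T)^T by rewrite !trmx_mul trmxK mulmxA.
by rewrite [RHS]mxE.
Qed.

Lemma LformNr a b : Lform a (- b) = - Lform a b.
Proof. by rewrite Lform_sym LformNl opprK Lform_sym. Qed.

Lemma Lform_self a : Lform a a = 0.
Proof. by have := Lform_sym a a; lia. Qed.

Lemma Lform_deltar a j : Lform a (delta_mx 0 j) = \sum_i a 0 i * La i j.
Proof. by rewrite /Lform trmx_delta -colE !mxE. Qed.

Lemma Lform_delta i j : Lform (delta_mx 0 i) (delta_mx 0 j) = La i j.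
Proof.
rewrite Lform_deltar (bigD1 i) //= big1 => [|k ki]; rewrite mxE eqxx.
  by rewrite eqxx mul1r addr0.
by rewrite (negbTE ki) mul0r.
Qed.

Lemma La_skew i j : La i j = - La j i.
Proof. by have := Lform_sym (delta_mx 0 i) (delta_mx 0 j); rewrite !Lform_delta. Qed.

(** The grouping by pairs i < j is the one used in the normalising exponent of [monomial]. *)
Lemma LformE a b : Lform a b =
  \sum_(i < N) \sum_(j < N | (i < j)%N)
     (a 0 i * La i j * b 0 j + a 0 j * La j i * b 0 i).
Proof.
have -> : Lform a b = \sum_(i < N) \sum_(j < N) a 0 i * La i j * b 0 j.
  rewrite /Lform mxE exchange_big; apply: eq_bigr => j _.
  by rewrite !mxE mulr_suml.
transitivity (\sum_(i < N) (\sum_(j < N | (i < j)%N) a 0 i * La i j * b 0 j +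
                            \sum_(j < N | (j < i)%N) a 0 i * La i j * b 0 j)).
  apply: eq_bigr => i _; rewrite (bigID (fun j : 'I_N => (i < j)%N)) /=.
  congr (_ + _); rewrite (bigD1 i) ?ltnn //=.
  have -> : La i i = 0 by have := La_skew i i; lia.
  rewrite mulr0 mul0r add0r; apply: eq_bigl => j.
  by rewrite -val_eqE /= -leqNgt ltn_neqAle andbC.
rewrite big_split /= [X in _ + X](exchange_big_dep xpredT) //= -big_split /=.
by apply: eq_bigr => i _; rewrite big_split.
Qed.

(** To interleave the two ordered products, each y_i has to pass exactly the z_j with j < i. *)
Lemma prod_qcomm_merge r (y z : 'I_r -> D) (e : 'I_r -> 'I_r -> int) :
  (forall i j : 'I_r, (j < i)%N -> qcomm (q ^ e i j) (y i) (z j)) ->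
  \prod_i y i * \prod_i z i =
  q ^ (\sum_(i < r) \sum_(j < r | (j < i)%N) e i j) *: \prod_i (y i * z i).
Proof.
elim: r y z e => [|r IH] y z e yz; first by rewrite !big_ord0 mul1r scale1r.
rewrite !big_ord_recr /=.
pose w := widen_ord (leqnSn r).
have yZ : y ord_max * \prod_i z (w i) =
    q ^ (\sum_i e ord_max (w i)) *: (\prod_i z (w i) * y ord_max).
  elim/big_rec2: _ => [|i E Z _ IHz]; first by rewrite mulr1 mul1r scale1r.
  rewrite mulrA [y _ * _](yz ord_max (w i)) /= ?ltn_ord //.
  by rewrite -scalerAl -[_ * y _ * Z]mulrA IHz -scalerAr scalerA mulrA expfzDr ?q_neq0.
rewrite mulrA -[\prod_i y _ * y _ * _]mulrA yZ -scalerAr -scalerAl.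
rewrite [\prod_i y _ * (_ * _)]mulrA.
rewrite (IH (y \o w) (z \o w) (fun i j => e (w i) (w j))) => [|i j ji]; last first.
  exact: yz.
rewrite -!scalerAl scalerA -expfzDr ?q_neq0 // -[_ * y _ * _]mulrA.
rewrite addrC; congr (q ^ (_ + _) *: _).
  rewrite [RHS]big_mkcond big_ord_recr /= ltnn addr0.
  by apply: eq_bigr => i _; rewrite ltn_ord.
apply: eq_bigr => i _; rewrite big_mkcond [RHS]big_mkcond big_ord_recr /=.
by rewrite (ltnNge r i) (ltnW (ltn_ord i)) addr0.
Qed.

(** The exponents produced by interleaving combine with the three normalising exponents to the value
    of the form; this is what the normalisation of [monomial] is made for. *)
Lemma monomialM a b :
  monomial x La a * monomial x La b = q ^ Lform a b *: monomial x La (a + b).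
Proof.
rewrite /monomial -scalerAl -scalerAr.
rewrite (@prod_qcomm_merge _ _ _ (fun i j => 2 * La i j * (a 0 i * b 0 j))); last first.
  move=> i j _; rewrite -exprz_exp; apply: qcommXz => //.
    by rewrite expfz_neq0 ?q_neq0.
  exact: (proj2 xLa).
rewrite !scalerA -!expfzDr ?q_neq0 //; congr (q ^ _ *: _); last first.
  by apply: eq_bigr => i _; rewrite mxE exprzDr ?xU.
rewrite LformE [X in _ + _ + X](exchange_big_dep xpredT) //= -!big_split /=.
apply: eq_bigr => i _; rewrite -!big_split /=; apply: eq_bigr => j _.
by rewrite (La_skew i j) !mxE; ring.
Qed.

Lemma monomial_deltaZ (k : 'I_N) (t : int) :
  monomial x La (t *: delta_mx 0 k) = x k ^ t.
Proof.
rewrite /monomial big1 => [|i _]; last first.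
  rewrite big1 // => j ij; rewrite !mxE eqxx /=; case: (eqVneq i k) => [<-|_].
    by rewrite (gtn_eqF ij : (j == i) = false) !mulr0.
  by rewrite mulr0 mulr0 mul0r.
rewrite scale1r (eq_bigr (fun i => if i == k then x k ^ t else 1)) => [|i _].
  by rewrite -big_mkcond big_pred1_eq.
by rewrite !mxE eqxx /=; case: eqP => [->|_]; rewrite ?mulr1 ?mulr0.
Qed.

Lemma monomial_delta (k : 'I_N) : monomial x La (delta_mx 0 k) = x k.
Proof. by rewrite -[delta_mx 0 k]scale1r monomial_deltaZ. Qed.

Lemma qcomm_monomial a b :
  qcomm (q ^ (2 * Lform a b)) (monomial x La a) (monomial x La b).
Proof.
rewrite /qcomm !monomialM [b + a]addrC [RHS]scalerA -expfzDr ?q_neq0 //.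
by have -> : 2 * Lform a b + Lform b a = Lform a b by rewrite (Lform_sym b a); lia.
Qed.

Lemma monomial_unit a : monomial x La a \is a GRing.unit.
Proof.
rewrite /monomial scaler_unit ?unitfE ?expfz_neq0 ?q_neq0 //.
apply: rpred_prod => i _; case: (a 0 i) => n; first by rewrite unitrX.
by rewrite NegzE -exprnN unitrV unitrX.
Qed.

End Monomials.

(** Products of units are non-zero and distinct powers of q are distinct scalars, so the variables
    determine the exponents. *)
Lemma Lambda_matrix_unique (D : unitAlgType K) (N : nat) (x : 'I_N -> D)
    (La La' : 'M[int]_N) : (forall i, x i \is a GRing.unit) ->
  is_Lambda_matrix x La -> is_Lambda_matrix x La' -> La = La'.
Proof.
move=> xU [_ xLa] [_ xLa']; apply/matrixP => i j.
have xx : x j * x i != 0.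
  apply/eqP => xx0; have : x j * x i \is a GRing.unit by rewrite unitrMl ?xU.
  by rewrite xx0 unitr0.
have := xLa i j; rewrite xLa' => /eqP; rewrite -subr_eq0 -scalerBl.
rewrite scaler_eq0 (negbTE xx) orbF subr_eq0 => /eqP /q_expz_inj /eqP.
by lia.
Qed.

(** * Compatible pairs *)

Section CompatiblePairs.

Variables (N : nat) (ex : {set 'I_N}) (La : 'M[int]_N).
Hypothesis La_skew : La^T = - La.
Implicit Types (B : 'M[int]_(N, #|ex|)) (c : 'I_#|ex|).

(* The double sum [B^T La B'] is evaluated with either compatible pair. *)
Lemma compatible_skew B B' c d : compatible_pair La B -> compatible_pair La B' ->
  B' (enum_val c) d = - B (enum_val d) c.
Proof.
move=> cB cB'; pose S : int := \sum_k \sum_l B k c * La k l * B' l d.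
have S1 : S = 2 * B' (enum_val c) d.
  rewrite /S exchange_big /= (bigD1 (enum_val c)) //= [X in _ + X]big1 ?addr0 => [|l lc].
    by rewrite -mulr_suml cB eqxx mulr1.
  by rewrite -mulr_suml cB (negbTE lc) mulr0 mul0r.
have skew k l : La k l = - La l k.
  by have := congr1 (fun M : 'M_N => M l k) La_skew; rewrite !mxE.
have S2 : S = - (2 * B (enum_val d) c).
  have cB'k k : \sum_l La k l * B' l d = - (2 * (k == enum_val d)%:R).
    rewrite -cB' -sumrN; apply: eq_bigr => l _.
    by rewrite skew mulNr mulrC.
  rewrite /S (bigD1 (enum_val d)) //= [X in _ + X]big1 ?addr0 => [|l lc].
    under eq_bigr do rewrite -mulrA; rewrite -mulr_sumr cB'k eqxx; lia.
  by under eq_bigr do rewrite -mulrA; rewrite -mulr_sumr cB'k (negbTE lc) !mulr0.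
by lia.
Qed.

(** The entry (c, d) of either principal part is minus the entry (d, c) of that of [B]: skewness is
    applied to [B] with [B'] and to [B] with itself. *)
Lemma compatible_principal B B' : compatible_pair La B -> compatible_pair La B' ->
  principal_part B' = principal_part B.
Proof.
move=> cB cB'; apply/matrixP => c d; rewrite !mxE.
by rewrite (compatible_skew c d cB cB') (compatible_skew c d cB cB).
Qed.

Definition set_column B c (v : 'rV[int]_N) : 'M[int]_(N, #|ex|) :=
  \matrix_(k, j) if j == c then v 0 k else B k j.

Lemma compatible_set_column B c (v : 'rV[int]_N) : compatible_pair La B ->
  (forall i, \sum_k v 0 k * La k i = 2 * (i == enum_val c)%:R) ->
  compatible_pair La (set_column B c v).
Proof.
move=> cB cv j i; have [->|jc] := eqVneq j c.
  by rewrite -cv; apply: eq_bigr => k _; rewrite mxE eqxx.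
by rewrite -cB; apply: eq_bigr => k _; rewrite mxE (negbTE jc).
Qed.

End CompatiblePairs.

(** * Mutation preserves quantum seeds *)

Section Mutation.

Variables (D : unitAlgType K) (N : nat) (ex : {set 'I_N}).
Variables (S : seed D ex) (c : 'I_#|ex|).
Hypotheses (xU : forall i, var S i \is a GRing.unit) (seedS : is_quantum_seed S).
Let x := var S.
Let La := Lambda S.
Let B := Bmx S.
Let i0 := enum_val c.
Let xLa : is_Lambda_matrix x La := proj1 seedS.
Let cB : compatible_pair La B := proj2 seedS.

Definition positive_part : 'rV[int]_N := \row_k Num.max 0 (B k c).
Definition negative_part : 'rV[int]_N := \row_k Num.max 0 (- B k c).

Lemma mutated_variableE : mutated_variable S c =
  monomial x La (positive_part - delta_mx 0 i0) +
  monomial x La (negative_part - delta_mx 0 i0).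
Proof.
have -> : positive_part = \sum_(k < N | 0 < B k c) B k c *: delta_mx 0 k.
  rewrite [LHS]row_sum_delta [RHS]big_mkcond; apply: eq_bigr => k _; rewrite mxE.
  by case: ltP; rewrite ?scale0r.
suff -> : negative_part = \sum_(k < N | B k c < 0) - B k c *: delta_mx 0 k by [].
rewrite [LHS]row_sum_delta [RHS]big_mkcond; apply: eq_bigr => k _; rewrite mxE -oppr_gt0.
by case: ltP; rewrite ?scale0r.
Qed.

Let w := negative_part - delta_mx 0 i0.

Lemma Bdiag0 d : B (enum_val d) d = 0.
Proof.
have : B (enum_val d) d = - B (enum_val d) d.
  exact: (compatible_skew (proj1 xLa) d d cB cB).
by lia.
Qed.

(** The columns of E are exponent vectors in the old variables: an old variable stands for itself,
    and the new one is represented by [w], one of its two monomials. The mutated Lambda consists of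
    their pairings. *)
Lemma row_mutation_E i :
  row i (mutation_E B c)^T = if i == i0 then w else delta_mx 0 i.
Proof.
apply/rowP => j; rewrite !mxE -/i0; case: (eqVneq i i0) => [->|ii]; rewrite !mxE.
  case: (eqVneq j i0) => [->|_]; last by rewrite andbF subr0.
  by rewrite Bdiag0 oppr0 maxxx sub0r.
by rewrite eqxx.
Qed.

Lemma mutated_LambdaE i j :
  ((mutation_E B c)^T *m La *m mutation_E B c) i j =
  Lform La (row i (mutation_E B c)^T) (row j (mutation_E B c)^T).
Proof.
rewrite /Lform -[row j _]tr_col trmxK -row_mul mxE [RHS]mxE.
by apply: eq_bigr => k _; rewrite [in RHS]mxE [col _ _ _ _]mxE.
Qed.

Lemma Lform_column b : Lform La (positive_part - negative_part) b = 2 * b 0 i0.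
Proof.
rewrite /Lform mxE (bigD1 i0) //= [X in _ + X]big1 => [|k ki]; rewrite !mxE.
  rewrite addr0; congr (_ * _); have := cB c i0; rewrite eqxx mulr1; apply: etrans.
  by apply: eq_bigr => k _; rewrite !mxE; congr (_ * _); lia.
rewrite [X in X * _](_ : _ = 0) ?mul0r //.
have := cB c k; rewrite (negbTE ki) mulr0; apply: etrans.
by apply: eq_bigr => l _; rewrite !mxE; congr (_ * _); lia.
Qed.

(** The exponents of the two monomials of the new variable differ by column [c] of [B]. By
    compatibility it pairs to 0 with every variable other than the mutated one, so both monomials
    commute with that variable up to the same power of q. *)
Lemma mutate_Lambda : is_Lambda_matrix (var (mutate S c)) (Lambda (mutate S c)).
Proof.
split=> [|i j] /=.
  by rewrite !trmx_mul trmxK (proj1 xLa) mulNmx mulmxN mulmxA.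
rewrite mutated_LambdaE !row_mutation_E !ffunE -/i0 mutated_variableE -/w.
have wpos : positive_part - delta_mx 0 i0 = (positive_part - negative_part) + w.
  by rewrite addrA subrK.
have mut_comm k : k != i0 -> qcomm (q ^ (2 * Lform La w (delta_mx 0 k)))
    (monomial x La (positive_part - delta_mx 0 i0) + monomial x La w) (x k).
  move=> ki; have xk : x k = monomial x La (delta_mx 0 k) by rewrite monomial_delta.
  rewrite /qcomm mulrDl mulrDr scalerDr xk; congr (_ + _).
    rewrite [LHS](qcomm_monomial xU xLa) wpos (LformDl La) Lform_column.
    by rewrite mxE eqxx eq_sym (negbTE ki) mulr0 add0r.
  exact: (qcomm_monomial xU xLa).
case: (eqVneq i i0) => [_|ii]; case: (eqVneq j i0) => [_|ji].
- by rewrite (Lform_self xLa) scale1r.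
- exact: mut_comm.
- have := qcomm_sym _ (mut_comm i ii); rewrite expfz_neq0 ?q_neq0 // => /(_ isT).
  by rewrite invr_expz (Lform_sym xLa (delta_mx 0 i)) mulrN.
- by rewrite Lform_delta; apply: (proj2 xLa).
Qed.

(** As E^2 = 1, the product (E B F)^T (E^T Lambda E) reduces to F^T (B^T Lambda) E. Here B^T Lambda
    = 2 J, so what remains is F^T J E = J. *)
Lemma mutate_compatible : compatible_pair (Lambda (mutate S c)) (Bmx (mutate S c)).
Proof.
pose J : 'M[int]_(#|ex|, N) := \matrix_(j, i) (i == enum_val j)%:R.
have BLa : B^T *m La = 2 *: J.
  apply/matrixP => j i; rewrite !mxE -cB; apply: eq_bigr => k _.
  by rewrite mxE.
(* E and F are the identity plus matrices of rank one, with [u] and [f] as the variable factors; the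
   entries -2 turn the diagonal entry 1 into -1. *)
pose u : 'cV[int]_N := (negative_part - 2 *: delta_mx 0 i0)^T.
pose f : 'rV[int]_#|ex| :=
  \row_b (if b == c then - 2 else Num.max 0 (B i0 b)).
have EE : mutation_E B c = 1%:M + u *m delta_mx 0 i0.
  apply/matrixP => a b; rewrite !mxE big_ord1 !mxE eqxx /= -/i0.
  case: (eqVneq b i0) => [->|_]; last by rewrite mulr0 addr0.
  case: (eqVneq a i0) => [->|_]; last by rewrite mulr1 add0r mulr0 subr0.
  by rewrite Bdiag0 oppr0 maxxx; lia.
have FE : mutation_F B c = 1%:M + delta_mx c 0 *m f.
  apply/matrixP => a b; rewrite !mxE big_ord1 !mxE eqxx andbT -/i0.
  case: (eqVneq a c) => [->|_]; last by rewrite mul0r addr0.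
  by rewrite mul1r eq_sym; case: eqVneq => [_|_]; rewrite ?add0r.
have du : (delta_mx 0 i0 : 'rV_N) *m u = (- 2)%:M.
  apply/matrixP => a b; rewrite !ord1 -rowE !mxE eqxx /= eqxx Bdiag0 oppr0 maxxx.
  by lia.
have Jc : delta_mx 0 c *m J = delta_mx 0 i0 :> 'rV_N.
  by rewrite -rowE; apply/rowP => k; rewrite !mxE eqxx.
have Ju : J *m u = f^T.
  apply/colP => j; rewrite !mxE (bigD1 (enum_val j)) //= big1 => [|k kj]; last first.
    by rewrite mxE (negbTE kj) mul0r.
  rewrite !mxE !eqxx /= mul1r addr0 (inj_eq enum_val_inj).
  case: (eqVneq j c) => [->|jc]; first by rewrite Bdiag0 oppr0 maxxx; lia.
  by rewrite (compatible_skew (proj1 xLa) c j cB cB) mulr0 subr0.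
have EE1 : mutation_E B c *m mutation_E B c = 1%:M.
  rewrite EE mulmxDl mul1mx mulmxDr mulmx1 -mulmxA (mulmxA _ u) du mul_scalar_mx.
  rewrite -scalemxAr scaleNr scaler_nat -[1%:M + _ + _]addrA.
  by rewrite [X in _ + X]addrA -mulr2n subrr addr0.
suff : (mutation_E B c *m B *m mutation_F B c)^T *m
    ((mutation_E B c)^T *m La *m mutation_E B c) = 2 *: J.
  move=> /matrixP JE j i; have := JE j i; rewrite !mxE => <-.
  by apply: eq_bigr => k _; rewrite [in RHS]mxE.
have EET : (mutation_E B c)^T *m (mutation_E B c)^T = 1%:M.
  by rewrite -trmx_mul EE1 trmx1.
transitivity ((mutation_F B c)^T *m
  (B^T *m ((mutation_E B c)^T *m (mutation_E B c)^T) *m La) *m mutation_E B c).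
  by rewrite !trmx_mul !mulmxA.
rewrite EET mulmx1 BLa -scalemxAr -scalemxAl; congr (_ *: _).
rewrite FE linearD /= trmx1 trmx_mul trmx_delta mulmxDl mul1mx -mulmxA Jc.
rewrite EE mulmxDl !mulmxDr !mulmx1 !mulmxA Ju -(mulmxA f^T) du.
rewrite mul_mx_scalar -scalemxAl scaleNr scaler_nat -addrA.
by rewrite [X in _ + X]addrA -mulr2n subrr addr0.
Qed.

Lemma mutate_quantum_seed : is_quantum_seed (mutate S c).
Proof. by split; [apply: mutate_Lambda | apply: mutate_compatible]. Qed.

End Mutation.

(** * Broken lines *)

Section Lines.

Variables (m n : nat).
Implicit Types (x y z : point m n) (L : {set point m n}).

Definition same_diag x y : bool := (x.1 + y.2 == y.1 + x.2)%N.

(* The only features of a broken line on which its variables depend. *)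
Definition staircase L : Prop :=
  (forall x y, x \in L -> y \in L ->
     ((x.1 <= y.1) && (y.2 <= x.2) || (y.1 <= x.1) && (x.2 <= y.2))%N) /\
  (forall y, exists2 z : point m n, z \in L & same_diag z y).

Lemma point_eq x y : x.1 = y.1 :> nat -> x.2 = y.2 :> nat -> x = y.
Proof.
by case: x y => [a b] [c d] /= ac bd; congr pair; apply: val_inj.
Qed.

Lemma staircase_uniq L x y : staircase L -> x \in L -> y \in L ->
  same_diag x y -> x = y.
Proof.
move=> [mono _] xL yL; rewrite /same_diag => /eqP xy.
by have /orP[] := mono x y xL yL; move=> /andP[? ?]; apply: point_eq; lia.
Qed.

Lemma line_step_val x y : line_step x y ->
  (y.1 + x.2 = (x.1 + y.2).+1)%N /\ (x.1 <= y.1)%N /\ (y.2 <= x.2)%N.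
Proof. by rewrite /line_step => /orP[] /andP[/eqP ? /eqP ?]; lia. Qed.

(** Both coordinates are monotone along the path. Each step changes the difference of row and column
    by exactly one, so a path between the two extreme diagonals meets all of them. *)
Lemma broken_line_staircase L : broken_line L -> staircase L.
Proof.
move=> [x0 [s [[x01 x02] [last1 last2] path_s ->]]]; split.
  pose r x y := ((x.1 <= y.1) && (y.2 <= x.2))%N.
  have r_trans : transitive r by move=> y x z; rewrite /r; lia.
  have : path r x0 s.
    by apply: sub_path path_s => x y /line_step_val[_ xy]; apply/andP.
  rewrite -[path r x0 s]/(sorted r (x0 :: s)) sorted_pairwise //.
  move=> /(pairwiseP x0) mono x y; rewrite !inE -!in_cons => xs ys.
  rewrite -(nth_index x0 xs) -(nth_index x0 ys).
  have [ij|ij|->] := ltngtP (index x (x0 :: s)) (index y (x0 :: s)).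
  - by apply/orP; left; apply: mono => //; rewrite inE index_mem.
  - by apply/orP; right; apply: mono => //; rewrite inE index_mem.
  - by rewrite !leqnn.
move=> y; have : (x0.1 + y.2 <= y.1 + x0.2)%N by have := ltn_ord y.2; lia.
have : (y.1 + (last x0 s).2 <= (last x0 s).1 + y.2)%N by have := ltn_ord y.1; lia.
elim: s x0 path_s {x01 x02 last1 last2} => [|x1 s IH] x0 /=.
  move=> _ ? ?; exists x0; first by rewrite !inE.
  by rewrite /same_diag; apply/eqP; lia.
move=> /andP[/line_step_val[step _] path_s] le_last.
rewrite leq_eqVlt => /predU1P[x0y|x0y].
  by exists x0; rewrite ?inE ?eqxx // /same_diag x0y.
have [|z] := IH x1 path_s le_last; first by lia.
by rewrite !inE => zs zy; exists z; rewrite ?inE ?zs ?orbT.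
Qed.

Lemma mem_above L x : staircase L -> (x \in above L) = [exists z in L, diag_lt x z].
Proof.
move=> stL; rewrite inE andb_idl // => /exists_inP[z zL /andP[xz dxz]].
apply: contraTN xz => xL; rewrite (staircase_uniq stL xL zL) ?ltnn //.
Qed.

Lemma above_mem L x z : staircase L -> z \in L -> diag_lt x z -> x \in above L.
Proof. by move=> stL zL xz; rewrite mem_above //; apply/exists_inP; exists z. Qed.

Lemma mem_region L x z : staircase L -> z \in L -> same_diag z x ->
  (x \in below L :|: L) = (z.1 <= x.1)%N.
Proof.
move=> stL zL zx; rewrite !inE; apply/idP/idP.
  case/orP => [/andP[_ /exists_inP[w wL /andP[wx /eqP dwx]]]|xL].
    rewrite -(@staircase_uniq _ w z stL) //; first by rewrite ltnW.
    by move: zx; rewrite /same_diag => /eqP; lia.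
  by rewrite (staircase_uniq stL zL xL zx).
rewrite leq_eqVlt => /predU1P[zx1|ltzx].
  by rewrite -(@point_eq z x) ?zL ?orbT //; move: zx; rewrite /same_diag => /eqP; lia.
case: (x \in L) => //=; rewrite orbF; apply/exists_inP; exists z => //.
by rewrite /diag_lt ltzx.
Qed.

(** If [y] came after [x] on the diagonal, it would exceed [z] strictly in both coordinates, against
    monotony. Thus the region on and below the line is closed under increasing either coordinate. *)
Lemma staircase_upper L x y z : staircase L -> z \in L ->
  (z.1 <= x.1)%N -> (z.2 <= x.2)%N -> y \in L -> same_diag y x -> (y.1 <= x.1)%N.
Proof.
move=> [mono _] zL zx1 zx2 yL; rewrite /same_diag => /eqP yx.
by have /orP[] := mono y z yL zL; move=> /andP[? ?]; lia.
Qed.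

Lemma not_above L x z : staircase L -> z \in L -> same_diag z x ->
  (x \notin above L) = (z.1 <= x.1)%N.
Proof.
move=> stL zL zx; rewrite mem_above // leqNgt; congr negb; apply/exists_inP/idP.
  move=> [w wL /andP[xw /eqP dxw]]; rewrite (@staircase_uniq _ z w stL) //.
  by move: zx; rewrite /same_diag => /eqP; lia.
move=> xz; exists z => //; rewrite /diag_lt xz.
by move: zx; rewrite /same_diag eq_sym => /eqP; lia.
Qed.

Definition diag_end x : point m n := [arg max_(b > x | diag_le x b) (b.1 - x.1)%N].

Lemma diag_le_refl x : diag_le x x.
Proof. by rewrite /diag_le leqnn eqxx. Qed.

Lemma diag_endP x : diag_le x (diag_end x) /\
  ((diag_end x).1.+1 = m \/ (diag_end x).2.+1 = n).
Proof.
rewrite /diag_end; case: arg_maxnP => [|[b1 b2] xb bmax]; first exact: diag_le_refl.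
split=> //=; have [bm|bm] := ltnP b1.+1 m; last by have := ltn_ord b1; left; lia.
have [bn|bn] := ltnP b2.+1 n; last by have := ltn_ord b2; right; lia.
move: xb => /andP[/= xb1 /eqP /= xb2].
have := bmax (Ordinal bm, Ordinal bn); rewrite /diag_le /=; lia.
Qed.

(** * The variables of a line as explicit solid minors *)

Section LineVariables.

Variables (A : algType K) (Z : 'I_m -> 'I_n -> A).

(** A box in the region has its upper left corner on or below the line, hence not before [z] on the
    diagonal. The box from [z] to [x] does fit, as the region is closed to the right and
    downwards. *)
Lemma line_variable_below L x z : staircase L -> z \in L -> diag_le z x ->
  line_variable Z L x = solid_minor Z z x.
Proof.
move=> stL zL /andP[zx1 zx2]; have zx : same_diag z x by [].
have boxE a : diag_le a x -> box a x \subset below L :|: L -> (z.1 <= a.1)%N.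
  move=> /andP[ax1 /eqP ax2] /subsetP /(_ a).
  rewrite (mem_region stL zL) /box ?inE ?leqnn ?ax1 //=; last first.
    by move: zx; rewrite /same_diag => /eqP; lia.
  by apply; move: zx; rewrite /same_diag => /eqP; lia.
rewrite /line_variable (mem_region stL zL zx) zx1.
congr (solid_minor Z _ x); case: arg_maxnP => [|[a1 a2]].
  rewrite diag_le_refl; apply/subsetP => y.
  rewrite inE => /andP[/andP[? ?] /andP[? ?]]; rewrite (mem_region stL zL).
    by lia.
  by move: zx; rewrite /same_diag => /eqP ?; apply/eqP; lia.
move=> /andP[ax boxa] amax.
have za : (z.1 <= a1)%N by apply: (boxE (a1, a2)).
have : (x.1 - z.1 <= x.1 - a1)%N.
  apply: amax; rewrite /diag_le zx1 zx2; apply/subsetP => y.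
  rewrite inE => /andP[/andP[zy1 _] /andP[zy2 _]].
  have [w wL wy] := proj2 stL y; rewrite (mem_region stL wL wy).
  exact: (staircase_upper stL zL zy1 zy2).
by move: ax zx2 => /andP[/= ? /eqP /= ?] /eqP ? ?; apply: point_eq => /=; lia.
Qed.

Lemma line_variable_above L x z : staircase L -> z \in L -> diag_lt x z ->
  line_variable Z L x = solid_minor Z x (diag_end x).
Proof.
move=> stL zL /andP[xz /eqP dxz]; rewrite /line_variable (mem_region stL zL).
  by rewrite leqNgt xz.
by rewrite /same_diag; apply/eqP.
Qed.

Lemma line_plus_staircase : staircase (line_plus m n).
Proof.
split=> [x y|y]; first by rewrite !inE; lia.
pose k := minn y.1 y.2.
have k1 : (y.1 - k < m)%N by have := ltn_ord y.1; lia.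
have k2 : (y.2 - k < n)%N by have := ltn_ord y.2; lia.
by exists (Ordinal k1, Ordinal k2); rewrite ?inE /same_diag /=; lia.
Qed.

(** Membership is expressed by the corners of the minor alone, so mutability can be tested in the
    same way for both lines. *)
Lemma covariantsP (v : A) : reflect
  (exists a b : point m n, [/\ (a.1 = 0%N :> nat) \/ (a.2 = 0%N :> nat),
     (b.1.+1 = m) \/ (b.2.+1 = n), diag_le a b & v = solid_minor Z a b])
  (v \in covariants Z).
Proof.
apply: (iffP imageP) => [[b]|[a [b [a0 bE ab ->]]]]; last first.
  exists b; first by rewrite inE; lia.
  by rewrite (line_variable_below line_plus_staircase (z := a)) // inE; lia.
rewrite inE => bE ->; have [a aL ab] := proj2 line_plus_staircase b.
have leab : diag_le a b.
  by move: aL ab; rewrite inE /same_diag /diag_le; lia.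
exists a, b; split=> //; [by move: aL; rewrite inE; lia | by lia |].
exact: line_variable_below line_plus_staircase aL leab.
Qed.

End LineVariables.

(** Since each diagonal carries one point of the line, the neighbours of [y] on the path are [a] and
    [b]; both remain one step away from [x], so [x] may take the place of [y]. *)
Lemma flip_broken_line L x y a b : broken_line L -> staircase L ->
  y \in L -> a \in L -> b \in L ->
  y.1 = x.1.+1 :> nat -> y.2 = x.2.+1 :> nat ->
  a.1 = x.1 :> nat -> a.2 = y.2 :> nat -> b.1 = y.1 :> nat -> b.2 = x.2 :> nat ->
  broken_line (x |: (L :\ y)).
Proof.
move=> [x0 [s [[x01 x02] [last1 last2] path_s LE]]] stL yL aL bL y1 y2 a1 a2 b1 b2.
pose f z := if z == y then x else z.
have f_id z : z != y -> f z = z by rewrite /f => /negbTE ->.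
have x0y : x0 != y by apply: contra_eqN x01 => /eqP ->; rewrite y1.
have lasty : last x0 s != y by apply: contra_eqN last2 => /eqP ->; rewrite y2.
exists (f x0), (map f s); rewrite last_map !f_id //; split=> //; last first.
  have -> : x0 :: map f s = map f (x0 :: s) by rewrite /= f_id.
  rewrite LE in_set in yL; rewrite LE.
  apply/setP => z; rewrite in_setU1 in_setD1 !in_set; apply/idP/mapP.
    case/predU1P => [->|/andP[zy zs]]; first by exists y; rewrite // /f eqxx.
    by exists z; rewrite // f_id.
  move=> [w ws ->]; rewrite /f; case: (eqVneq w y) => [_|wy]; first by rewrite eqxx.
  by rewrite wy ws orbT.
rewrite -{1}(f_id x0) // path_map.
apply: (sub_in_path (P := [in L])) path_s; last first.
  by apply/allP => z zs; rewrite /= LE in_set.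
move=> z w zL wL zw; have [step [zw1 zw2]] := line_step_val zw.
rewrite /= /f; case: (eqVneq z y) => [zy|zy]; case: (eqVneq w y) => [wy|wy] //.
- by move: zw; rewrite zy wy /line_step; lia.
- have -> : w = b; last by rewrite /line_step b1 b2 y1 !eqxx orbT.
  apply: (staircase_uniq stL) => //; rewrite /same_diag b1 b2; apply/eqP.
  by move: step; rewrite zy y2; clear; lia.
- have -> : z = a; last by rewrite /line_step a1 a2 y2 !eqxx.
  apply: (staircase_uniq stL) => //; rewrite /same_diag a1 a2; apply/eqP.
  by move: step; rewrite wy y1; clear; lia.
Qed.

(** Among the points above [L1] but not above [L2], one with the largest coordinate sum sits in a
    corner of [L1]. Flipping that corner gives a line bigger than [L1] and at most [L2], hence [L2]
    itself. *)
Lemma closest_bigger_flip L1 L2 : broken_line L1 -> broken_line L2 ->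
  closest_bigger L1 L2 -> exists x y a b : point m n,
  [/\ y.1 = x.1.+1 :> nat /\ y.2 = x.2.+1 :> nat,
      (a.1 = x.1 /\ b.2 = x.2) /\ (a.2 = y.2 /\ b.1 = y.1),
      [/\ y \in L1, a \in L1 & b \in L1] & L2 = x |: (L1 :\ y)].
Proof.
move=> bL1 bL2 [/andP[/subsetP le12 neq12] noL].
have st1 := broken_line_staircase bL1; have st2 := broken_line_staircase bL2.
pose R x := (x \in above L1) && (x \notin above L2).
have [x0 Rx0] : exists x, R x.
  have [sub21|/subsetPn[z2 z2L2 z2L1]] := boolP (L2 \subset L1).
    case/eqP: neq12; apply/setP => z; apply/idP/idP => [zL1|]; last first.
      exact: (subsetP sub21).
    have [w wL2 wz] := proj2 st2 z.
    by rewrite -(@staircase_uniq L1 w z) // (subsetP sub21).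
  exists z2; have [z1 z1L1 z12] := proj2 st1 z2.
  rewrite /R (not_above st2 z2L2) ?leqnn /same_diag // andbT.
  apply: contraTT z2L2; rewrite (not_above st1 z1L1 z12) => le_z12.
  apply/negP => z2L2.
  have lt_z12 : diag_lt z1 z2.
    move: z12; rewrite /diag_lt /same_diag => /eqP z12.
    rewrite ltn_neqAle le_z12 andbT z12 eqxx andbT.
    apply: contraNneq z2L1 => z12'; rewrite -(@point_eq z1 z2) //; lia.
  have := le12 z1 (above_mem st2 z2L2 lt_z12).
  by rewrite inE z1L1.
have [x [x1 x2 xmax]] : exists x, [/\ x \in above L1, x \notin above L2 &
    forall w, R w -> (w.1 + w.2 <= x.1 + x.2)%N].
  have [x /andP[x1 x2] xmax] := arg_maxnP (fun x : point m n => x.1 + x.2)%N Rx0.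
  by exists x; split.
have [z zL1 /andP[xz /eqP dxz]] : exists2 z : point m n, z \in L1 & diag_lt x z.
  by apply/exists_inP; rewrite -mem_above.
have y1m : (x.1.+1 < m)%N := leq_ltn_trans xz (ltn_ord z.1).
have xz2 : (x.2 < z.2)%N by lia.
have y2n : (x.2.+1 < n)%N := leq_ltn_trans xz2 (ltn_ord z.2).
have notR1 (w : point m n) : (w.1 <= x.1)%N -> (w.2 <= x.2)%N -> w \notin L1.
  move=> wx1 wx2; apply/negP => wL1.
  have [v vL1 vx] := proj2 st1 x.
  have := not_above st1 vL1 vx; rewrite x1 (staircase_upper st1 wL1 wx1 wx2 vL1 vx).
  by [].
have R2 (w : point m n) : (x.1 <= w.1)%N -> (x.2 <= w.2)%N -> w \notin above L2.
  move=> xw1 xw2; have [v vL2 vx] := proj2 st2 x.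
  have [u uL2 uw] := proj2 st2 w; have := vx; rewrite /same_diag => /eqP dvx.
  have le_vx : (v.1 <= x.1)%N by rewrite -(not_above st2 vL2 vx).
  rewrite (not_above st2 uL2 uw) (staircase_upper st2 vL2 _ _ uL2 uw) //;
    by clear - le_vx dvx xw1 xw2; lia.
(* The neighbours of [x] are not above [L2], so by maximality not above [L1] either. If one were off
   [L1], the point of [L1] on its diagonal would have both coordinates at most those of [x],
   contradicting that [x] is above [L1]. *)
have corner (w : point m n) : (x.1 <= w.1 <= x.1.+1)%N -> (x.2 <= w.2 <= x.2.+1)%N ->
    (x.1 + x.2 < w.1 + w.2)%N -> w \in L1.
  move=> /andP[xw1 wx1] /andP[xw2 wx2] xw.
  have w1 : w \notin above L1.
    apply: contraTN xw => w1; rewrite -leqNgt; apply: xmax.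
    by rewrite /R w1 R2.
  have [v vL1 vw] := proj2 st1 w.
  move: w1; rewrite (not_above st1 vL1 vw) => vw1.
  have [->//|nvw] := eqVneq w v.
  move: vw; rewrite /same_diag => /eqP dvw.
  have v1 : v.1 != w.1 :> nat.
    by apply: contraNneq nvw => vw'; apply/eqP/point_eq; lia.
  have le1 : (v.1 <= x.1)%N by lia.
  have le2 : (v.2 <= x.2)%N by lia.
  by have := notR1 v le1 le2; rewrite vL1.
pose y : point m n := (Ordinal y1m, Ordinal y2n).
pose a : point m n := (x.1, Ordinal y2n); pose b : point m n := (Ordinal y1m, x.2).
have yL : y \in L1 by apply: corner => /=; lia.
have aL : a \in L1 by apply: corner => /=; lia.
have bL : b \in L1 by apply: corner => /=; lia.
exists x, y, a, b; split=> //.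
have bL' : broken_line (x |: (L1 :\ y)).
  exact: (flip_broken_line (a := a) (b := b) bL1).
have st' := broken_line_staircase bL'.
have xL1 : x \notin L1 by apply: notR1.
apply/esym/eqP; apply: contraT => neq; case: noL; exists (x |: (L1 :\ y)).
split=> //; apply/andP; split=> //.
- apply/subsetP => u; rewrite (mem_above _ st') => /exists_inP[w].
  rewrite in_setU1 in_setD1 => /predU1P[->|/andP[_ wL1]] uw; last first.
    exact: above_mem st1 wL1 uw.
  apply: (above_mem st1 yL); by move: uw; rewrite /diag_lt /=; clear; lia.
- by apply: contraNneq xL1 => ->; rewrite !inE eqxx.
- apply/subsetP => u uL2; have := le12 u uL2; rewrite mem_above //.
  move=> /exists_inP[w wL1 uw].
  have [wy|wy] := eqVneq w y; last first.
    by apply: (above_mem st' (z := w)) uw; rewrite !inE wy wL1 orbT.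
  apply: (above_mem st' (z := x)); first by rewrite !inE eqxx.
  move: uL2; rewrite mem_above // => /exists_inP[v vL2 /andP[uv /eqP duv]].
  move: uw; rewrite wy /diag_lt /= => /andP[uy /eqP duy].
  have vx : same_diag v x.
    by rewrite /same_diag; apply/eqP; clear - duv duy; lia.
  by move: x2; rewrite (not_above st2 vL2 vx); clear - uv duy; lia.
Qed.

End Lines.

(** * Solid minors *)

Lemma qdet_diagonal (F : fieldType) (A : algType F) (p : F) (r : nat)
    (V : nat -> nat -> A) : (forall k l, k != l -> V k l = 0) ->
  qdet p r V = \prod_(k < r) V k k.
Proof.
move=> V0; rewrite /qdet (bigD1 1%g) //= [X in _ + X]big1 ?addr0 => [|s s1].
  rewrite (_ : inversions 1%g = 0%N) ?expr0 ?scale1r.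
    by apply: eq_bigr => k _; rewrite perm1.
  apply/eqP; rewrite cards_eq0 -subset0; apply/subsetP => -[a b].
  by rewrite !inE !perm1 /=; lia.
have [k sk] : exists k, s k != k.
  apply/existsP; apply: contraR s1; rewrite negb_exists => /forallP s1.
  by apply/eqP/permP => k; rewrite perm1; apply/eqP; rewrite -[_ == _]negbK.
suff -> : \prod_(k < r) V k (s k) = 0 by rewrite scaler0.
have Vk : V k (s k) = 0 by apply: V0; rewrite val_eqE eq_sym.
have := mem_index_enum k; elim: (index_enum _) => // i e IH.
rewrite inE big_cons => /predU1P[<-|/IH ->]; last by rewrite mulr0.
by rewrite Vk mul0r.
Qed.

(** The support condition leaves no non-zero entry in row 0 if a < b, and none in the last row if b
    < a. *)
Lemma qdet_off_diagonal (F : fieldType) (A : algType F) (p : F) (r a b : nat)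
    (V : nat -> nat -> A) : (0 < r)%N -> a != b ->
  (forall k l, (k + a != l + b)%N -> V k l = 0) -> qdet p r V = 0.
Proof.
case: r => // r _ ab V0; apply: big1 => s _.
suff -> : \prod_(k < r.+1) V k (s k) = 0 by rewrite scaler0.
have [lt_ab|lt_ba|eq_ab] := ltngtP a b; last by rewrite eq_ab eqxx in ab.
  by rewrite big_ord_recl V0 ?mul0r //=; lia.
rewrite big_ord_recr /= V0 ?mulr0 //=.
by case: (s ord_max) => x xr /=; lia.
Qed.

Section Minors.

Variables (m n : nat) (A : algType K) (Z : 'I_m -> 'I_n -> A).
Implicit Types (a b : point m n).

Lemma insubdE (r : nat) (x : 'I_r) (v : nat) : (v < r)%N -> insubd x v = v :> nat.
Proof. by move=> vr; rewrite insubdK. Qed.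

(** The bridge from minors to [qdet]; [f] will be the embedding into the skew field as well as a
    character. *)
Lemma solid_minor_qdet (B : algType K) (f : {lrmorphism A -> B})
    (V : nat -> nat -> B) a b : diag_le a b ->
  (forall k l, (k <= b.1 - a.1)%N -> (l <= b.1 - a.1)%N ->
     f (Z (insubd a.1 (a.1 + k)%N) (insubd a.2 (a.2 + l)%N)) = V k l) ->
  f (solid_minor Z a b) = qdet (q ^+ 2) (b.1 - a.1).+1 V.
Proof.
move=> ab fV; rewrite /solid_minor /qminor raddf_sum; apply: eq_bigr => s _.
rewrite /= linearZ /= rmorph_prod /=; congr (_ *: _); apply: eq_bigr => k _.
by apply: fV; rewrite -ltnS ltn_ord.
Qed.

Hypothesis hA : is_qmatrix_algebra Z.

(* These characters distinguish all solid minors. *)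
Lemma diagonal_character a (c : nat -> K) : exists f : {lrmorphism A -> K^o},
  forall i j, f (Z i j) = if (i + a.2 == a.1 + j)%N then c i else 0.
Proof.
pose W (i : 'I_m) (j : 'I_n) : K^o := if (i + a.2 == a.1 + j)%N then c i else 0.
suff qW : qmatrix_relations W by have [f fW _] := proj2 hA _ W qW; exists f.
(* A product of two entries vanishes unless both lie on one diagonal, so the relations reduce to 0 =
   0 or to commutativity. *)
have W0 (i s : 'I_m) (j t : 'I_n) : (i + t != s + j)%N -> W i j * W s t = 0.
  rewrite /W => ijst; case: eqP => [ij|_]; last by rewrite mul0r.
  by case: eqP => [st|_]; [lia | rewrite mulr0].
split=> [i j k jk|i k j ik|i s j t si jt|i s j t is_ jt].
- by rewrite !W0 ?scaler0 //; lia.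
- by rewrite !W0 ?scaler0 //; lia.
- exact: mulrC.
- by rewrite [X in _ = X + _]mulrC (W0 i s t j) ?scaler0 ?addr0 //; lia.
Qed.

Lemma diagonal_character_minor a (c : nat -> K) (f : {lrmorphism A -> K^o}) b e :
  (forall i j, f (Z i j) = if (i + a.2 == a.1 + j)%N then c i else 0) ->
  diag_le b e ->
  f (solid_minor Z b e) = if same_diag b a
    then \prod_(k < (e.1 - b.1).+1) c (b.1 + k)%N else 0.
Proof.
move=> fZ be; have [be1 /eqP be2] := andP be.
rewrite (@solid_minor_qdet _ f (fun k l => if (b.1 + k + a.2 == a.1 + (b.2 + l))%N
   then c (b.1 + k)%N else 0)) // => [|k l ke le]; last first.
  have := ltn_ord e.1; have := ltn_ord e.2 => e2 e1.
  by rewrite fZ !insubdE //; lia.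
case: (boolP (same_diag b a)) => ba; move: ba; rewrite /same_diag => ba.
  rewrite qdet_diagonal => [|k l kl]; last first.
    by rewrite ifN //; apply: contra kl; lia.
  by apply: eq_bigr => k _; rewrite ifT //; lia.
apply: (@qdet_off_diagonal _ _ _ _ (b.1 + a.2) (a.1 + b.2)) => // k l kl.
by rewrite ifN //; apply: contra kl; lia.
Qed.

Lemma solid_minor_neq0 a b : diag_le a b -> solid_minor Z a b != 0.
Proof.
move=> ab; have [f fZ] := diagonal_character a (fun=> 1).
have := diagonal_character_minor (c := fun=> 1) fZ ab; rewrite /same_diag eqxx big1 //.
by apply: contra_eq_neq => ->; rewrite raddf0 eq_sym oner_neq0.
Qed.

(** The character with value 1 on the rows from [a] to [b] of this diagonal and 0 elsewhere sends
    the first minor to 1. The second can have value 1 only if it lies on the same diagonal and uses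
    only these rows. *)
Lemma solid_minor_rows a b a' b' : diag_le a b -> diag_le a' b' ->
  solid_minor Z a b = solid_minor Z a' b' ->
  same_diag a' a /\ (a.1 <= a'.1)%N /\ (b'.1 <= b.1)%N.
Proof.
move=> ab ab' eq_minor.
pose c i : K := ((a.1 <= i <= b.1)%N)%:R.
have [f fZ] := diagonal_character a c.
have := diagonal_character_minor (c := c) fZ ab; rewrite eq_minor.
rewrite (diagonal_character_minor (c := c) fZ ab') {2}/same_diag eqxx.
rewrite [RHS]big1 => [|k _]; last first.
  by rewrite /c (_ : _ && _) //; have := ltn_ord k; move: ab; rewrite /diag_le; lia.
case: ifP => [a'a prod1|_ /eqP]; last by rewrite eq_sym oner_eq0.
have c1 k : (k <= b'.1 - a'.1)%N -> (a.1 <= a'.1 + k <= b.1)%N.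
  rewrite -ltnS => kb; apply: contra_eqT prod1 => /negbTE ck.
  by rewrite (bigD1 (Ordinal kb)) //= /c ck mul0r eq_sym oner_neq0.
have := c1 0%N (leq0n _); have := c1 (b'.1 - a'.1)%N (leqnn _).
by move: ab'; rewrite /diag_le; lia.
Qed.

Lemma solid_minor_inj a b a' b' : diag_le a b -> diag_le a' b' ->
  solid_minor Z a b = solid_minor Z a' b' -> a = a' /\ b = b'.
Proof.
move=> ab ab' eq_minor.
have [d [? ?]] := solid_minor_rows ab ab' eq_minor.
have [_ [? ?]] := solid_minor_rows ab' ab (esym eq_minor).
move: ab ab' d; rewrite /diag_le /same_diag => /andP[_ /eqP ?] /andP[_ /eqP ?] /eqP ?.
by split; apply: point_eq; lia.
Qed.

End Minors.

(** * Exchange relations *)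

(* [u] and [v] are linearly independent, as they commute with [x] up to
   different scalars. *)
Lemma qcomm_summands (F : fieldType) (D : unitAlgType F) (x y u v : D) (d e f g r : F) :
  x \is a GRing.unit -> y \is a GRing.unit -> u != 0 -> v != 0 ->
  d != 1 -> r != 0 -> qcomm 1 x u -> qcomm d x v ->
  qcomm f u y -> qcomm g v y -> qcomm e (u + r *: v) y -> f = g.
Proof.
move=> xU yU u0 v0 d1 r0 xu xv uy vy uvy.
pose al := f - e; pose be := r * (g - e).
have dep : al *: u + be *: v = 0.
  apply: (mulrI yU); rewrite mulr0.
  move: uvy; rewrite /qcomm mulrDl -scalerAl uy vy mulrDr scalerDr -scalerAr => /eqP.
  rewrite -subr_eq0 opprD addrACA !scalerA -!scalerBl => /eqP uvy.
  by rewrite mulrDr -!scalerAr -[RHS]uvy /al /be mulrBr [_ * e]mulrC.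
have depd : al *: u + (d * be) *: v = 0.
  apply: (mulIr xU); rewrite mul0r -[RHS](mulr0 x) -dep.
  rewrite mulrDr mulrDl -!scalerAr -!scalerAl.
  by rewrite [x * u]xu [x * v]xv scale1r scalerA mulrC.
have be0 : be = 0.
  have : (be - d * be) *: v = 0.
    rewrite scalerBl; apply/eqP; rewrite subr_eq0; apply/eqP.
    by apply: (addrI (al *: u)); rewrite dep depd.
  move=> /eqP; rewrite scaler_eq0 (negbTE v0) orbF -{1}[be]mul1r -mulrBl.
  by rewrite mulf_eq0 subr_eq0 eq_sym (negbTE d1) => /eqP.
have al0 : al = 0.
  move: dep; rewrite be0 scale0r addr0 => /eqP.
  by rewrite scaler_eq0 (negbTE u0) orbF => /eqP.
move/eqP: be0; rewrite /be mulf_eq0 (negbTE r0) /= subr_eq0.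
by move=> /eqP ->; apply/eqP; rewrite -subr_eq0 -/al al0.
Qed.

(** * From an exchange relation to a modification followed by a mutation *)

Section ExchangeStep.

Variables (D : unitAlgType K) (N : nat) (ex : {set 'I_N}).
Variables (S : seed D ex) (c : 'I_#|ex|) (wA wB : 'rV[int]_N) (G : D).
Let x := var S.
Let La := Lambda S.
Let i0 := enum_val c.
Let XA := monomial x La wA.
Let XB := monomial x La wB.

Hypotheses (xU : forall i, x i \is a GRing.unit) (seedS : is_quantum_seed S).
Hypotheses (w_ge0 : forall k, 0 <= wA 0 k /\ 0 <= wB 0 k)
  (w_disjoint : forall k, wA 0 k = 0 \/ wB 0 k = 0).
Hypotheses (exchange : G * x i0 = XA + q ^ (- 2) *: XB)
  (commA : qcomm 1 (x i0) XA) (commB : qcomm (q ^ 4) (x i0) XB).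
Hypothesis commG : forall k, k != i0 -> exists s : int, qcomm (q ^ s) G (x k).

Let xLa : is_Lambda_matrix x La := proj1 seedS.

(** By [w_ge0] and [w_disjoint], [wA] and [wB] are the positive and negative parts of the new
    column. *)
Definition exchange_seed : seed D ex :=
  {| var := var S; Lambda := Lambda S; Bmx := set_column (Bmx S) c (wA - wB) |}.

Lemma qcomm_monomial_expz (w : 'rV[int]_N) k (s : int) :
  qcomm (q ^ s) (monomial x La w) (x k) -> s = 2 * Lform La w (delta_mx 0 k).
Proof.
have := qcomm_monomial xU xLa w (delta_mx 0 k); rewrite (monomial_delta x La).
rewrite /qcomm => -> /eqP; rewrite -subr_eq0 -scalerBl scaler_eq0 => /orP[|/eqP xw].
  by rewrite subr_eq0 => /eqP /q_expz_inj.
have : x k * monomial x La w \is a GRing.unit.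
  by rewrite unitrMl ?monomial_unit.
by rewrite xw unitr0.
Qed.

Let LA0 : Lform La wA (delta_mx 0 i0) = 0.
Proof.
have commA' : qcomm (q ^ 0) XA (x i0).
  by have := qcomm_sym (oner_neq0 _) commA; rewrite invr1.
by have := qcomm_monomial_expz commA'; lia.
Qed.

Let LB0 : Lform La wB (delta_mx 0 i0) = - 2.
Proof.
have commB' : qcomm (q ^ (- 4)) XB (x i0).
  by rewrite -invr_expz; apply: qcomm_sym commB; rewrite expfz_neq0 ?q_neq0.
by have := qcomm_monomial_expz commB'; lia.
Qed.

(** At [i0] the value is 0 - (-2). Elsewhere [XA + q ^ (- 2) *: XB] equals [G * x i0] and so
    commutes with [x i] up to a scalar; the independence of its summands forces equal scalars for
    [XA] and [XB]. *)
Lemma exchange_column i :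
  \sum_k (wA - wB) 0 k * La k i = 2 * (i == i0)%:R.
Proof.
rewrite -Lform_deltar LformDl LformNl; case: eqVneq => [->|ii]; first by rewrite LA0 LB0.
suff : q ^ (2 * Lform La wA (delta_mx 0 i)) = q ^ (2 * Lform La wB (delta_mx 0 i)).
  by move/q_expz_inj; lia.
have [s Gs] := commG ii.
have monomial_neq0 w : monomial x La w != 0.
  by apply/eqP => w0; have := monomial_unit La xU w; rewrite w0 unitr0.
have xcomm w : qcomm (q ^ (2 * Lform La w (delta_mx 0 i))) (monomial x La w) (x i).
  by have := qcomm_monomial xU xLa w (delta_mx 0 i); rewrite (monomial_delta x La).
apply: (qcomm_summands (xU i0) (xU i) (monomial_neq0 _) (monomial_neq0 _) _ _
          commA commB (xcomm _) (xcomm _) (r := q ^ (- 2))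
          (e := q ^ s * q ^ (2 * La i0 i))).
- by apply/eqP => /q_expz_eq1.
- by rewrite expfz_neq0 ?q_neq0.
- by rewrite -exchange; apply: (qcommMl Gs); apply: (proj2 xLa).
Qed.

Lemma exchange_seed_quantum : is_quantum_seed exchange_seed.
Proof.
split; first exact: xLa.
exact: compatible_set_column (proj2 seedS) exchange_column.
Qed.

Lemma exchange_seed_principal :
  principal_part (Bmx exchange_seed) = principal_part (Bmx S).
Proof.
by apply: (compatible_principal (proj1 xLa) (proj2 seedS)); case: exchange_seed_quantum.
Qed.

(** Dividing a normalised monomial by [x i0] introduces a power of q given by the form: q^0 for [wA]
    and q^(-2) for [wB]. These are the coefficients of the exchange relation. *)
Lemma exchange_seed_mutated : mutated_variable exchange_seed c = G.
Proof.
rewrite mutated_variableE ?exchange_seed_quantum //=.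
have -> : positive_part exchange_seed c = wA.
  apply/rowP => k; rewrite !mxE eqxx.
  have [wA0 wB0] := w_ge0 k; case: (w_disjoint k) => ->.
    by rewrite sub0r max_l // oppr_le0.
  by rewrite subr0 max_r.
have -> : negative_part exchange_seed c = wB.
  apply/rowP => k; rewrite !mxE eqxx.
  have [wA0 wB0] := w_ge0 k; case: (w_disjoint k) => ->.
    by rewrite sub0r opprK max_r.
  by rewrite subr0 max_l // oppr_le0.
have xV : monomial x La (- delta_mx 0 i0) = (x i0)^-1.
  by rewrite -scaleN1r (monomial_deltaZ x La).
have divX w : monomial x La (w - delta_mx 0 i0) =
    q ^ Lform La w (delta_mx 0 i0) *: (monomial x La w * (x i0)^-1).
  rewrite -xV (monomialM xU xLa) (LformNr xLa) scalerA -expfzDr ?q_neq0 //.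
  by rewrite subrr scale1r.
rewrite -/i0 !divX LA0 LB0 scale1r scalerAl -mulrDl -exchange.
by rewrite mulrK ?xU.
Qed.

End ExchangeStep.

Lemma monomial_delta2 (D : unitAlgType K) (N : nat) (x : 'I_N -> D)
    (La : 'M[int]_N) (i j : 'I_N) :
  (forall k, x k \is a GRing.unit) -> is_Lambda_matrix x La ->
  x i * x j = x j * x i -> monomial x La (delta_mx 0 i + delta_mx 0 j) = x i * x j.
Proof.
move=> xU xLa xij.
have L0 : Lform La (delta_mx 0 i) (delta_mx 0 j) = 0.
  have : x i * x j = q ^ (2 * La i j) *: (x i * x j) by rewrite {2}xij (proj2 xLa).
  move=> /eqP; rewrite -{1}[x i * x j]scale1r -subr_eq0 -scalerBl scaler_eq0.
  have xx : x i * x j \is a GRing.unit by rewrite unitrMl ?xU.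
  case/orP => [|/eqP xx0]; last by rewrite xx0 unitr0 in xx.
  by rewrite subr_eq0 Lform_delta => /eqP/esym/q_expz_eq1; lia.
have := monomialM xU xLa (delta_mx 0 i) (delta_mx 0 j).
by rewrite L0 scale1r !(monomial_delta x La).
Qed.

(** * The corner flip *)

Section SeedChains.

Variables (D : unitAlgType K) (N : nat) (ex : {set 'I_N}).
Implicit Types (S : seed D ex).

(** Modifications have even index and mutations odd index; [odd k == true] is the condition of the
    theorem for [first = true]. *)
Definition seed_step (k : nat) S S' : Prop :=
  if odd k == true then mutation_move S S'
  else B_modification S S' /\ principal_part (Bmx S') = principal_part (Bmx S).

Definition seed_chain S0 (len : nat) S : Prop := exists Q : nat -> seed D ex,
  [/\ Q 0%N = S0, Q len = S, forall k, (k <= len)%N -> is_quantum_seed (Q k)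
    & forall k, (k < len)%N -> seed_step k (Q k) (Q k.+1)].

Lemma seed_chain0 S0 : is_quantum_seed S0 -> seed_chain S0 0 S0.
Proof. by move=> seed0; exists (fun=> S0). Qed.

Lemma seed_chain_quantum S0 len S : seed_chain S0 len S -> is_quantum_seed S.
Proof. by move=> [Q [_ <- seedQ _]]; apply: seedQ. Qed.

Lemma seed_chainS S0 len S S' : seed_chain S0 len S -> is_quantum_seed S' ->
  seed_step len S S' -> seed_chain S0 len.+1 S'.
Proof.
move=> [Q [Q0 QS seedQ stepQ]] seedS' stepS.
exists (fun k => if (k <= len)%N then Q k else S').
split=> [||k _|k] /=; rewrite ?ltnn ?leq0n //; first by case: leqP => // /seedQ.
rewrite ltnS => k_le; rewrite k_le; case: ltngtP k_le => // [kl|->] _.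
  exact: stepQ.
by rewrite QS.
Qed.

End SeedChains.

(** * The two families of minors on the diagonal of the corner *)

Section Flip.

Variables (m n : nat) (A : algType K) (Z : 'I_m -> 'I_n -> A).
Hypothesis hA : is_qmatrix_algebra Z.
Variables (D : unitAlgType K) (iota : {lrmorphism A -> D}).
Hypothesis hD : is_skew_field_of_fractions iota.
Variables (L1 L2 : {set point m n}) (o y a b : point m n).
Hypotheses (st1 : staircase L1) (st2 : staircase L2).
Hypotheses (y1 : y.1 = o.1.+1 :> nat) (y2 : y.2 = o.2.+1 :> nat)
  (a1 : a.1 = o.1) (a2 : a.2 = y.2) (b1 : b.1 = y.1) (b2 : b.2 = o.2).
Hypotheses (yL1 : y \in L1) (aL1 : a \in L1) (bL1 : b \in L1)
  (L2E : L2 = o |: (L1 :\ y)).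
Implicit Types (w : point m n) (s t : nat).

Let p := q ^+ 2.
(** [T] is the distance along the diagonal from the corner [o] to the border; for indices up to [T]
    the defaults of [insubd] are not reached in [dpt] and [U]. *)
Let T := ((diag_end o).1 - o.1)%N.
Let dpt s : point m n := (insubd o.1 (o.1 + s)%N, insubd o.2 (o.2 + s)%N).
Let on_diag w := same_diag w o && (o.1 <= w.1)%N.
Let U k l : D := iota (Z (insubd o.1 (o.1 + k)%N) (insubd o.2 (o.2 + l)%N)).
Let Fm s := qdet p s.+1 U.
Let Gm s := qdet p s.+1 (fun k l => U k.+1 l.+1).

Let end_val : (diag_end o).1 = (o.1 + T)%N :> nat /\ (diag_end o).2 = (o.2 + T)%N :> nat.
Proof.
by have [/andP[e1 /eqP e2] _] := diag_endP o; rewrite /T; split; lia.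
Qed.

Let dptE s : (s <= T)%N ->
  (dpt s).1 = (o.1 + s)%N :> nat /\ (dpt s).2 = (o.2 + s)%N :> nat.
Proof.
move=> sT; have [e1 e2] := end_val; have := ltn_ord (diag_end o).1.
have := ltn_ord (diag_end o).2; rewrite e1 e2 => ? ?.
by split; rewrite /= insubdE //; lia.
Qed.

Let on_diag_dpt s : (s <= T)%N -> on_diag (dpt s).
Proof.
by move=> sT; have [d1 d2] := dptE sT; rewrite /on_diag /same_diag d1 d2; lia.
Qed.

Let on_diagP w : on_diag w ->
  exists2 s, (s <= T)%N & w = dpt s /\ (w.1 - o.1)%N = s.
Proof.
move=> /andP[/eqP wo ow]; have [_ eE] := diag_endP o; have [e1 e2] := end_val.
have sT : (w.1 - o.1 <= T)%N by have := ltn_ord w.1; have := ltn_ord w.2; lia.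
exists (w.1 - o.1)%N => //; split=> //; have [d1 d2] := dptE sT.
by apply: point_eq; lia.
Qed.

Lemma frame_qmat N : (N <= T.+1)%N -> qmat p N U.
Proof.
move=> NT; have vE k (kN : (k < N)%N) := dptE (leq_trans kN NT : (k <= T)%N).
have [[rowZ colZ antiZ diagZ] _] := hA.
rewrite /qmat /U; split=> [i j t iN /andP[jt tN]|i s j /andP[is_ sN] jN
    |i s j t /andP[si iN] /andP[jt tN]|i s j t /andP[is_ sN] /andP[jt tN]].
- have [[_ vj] [_ vt]] := (vE j (ltn_trans jt tN), vE t tN).
  by rewrite -!rmorphM rowZ /= ?linearZ //; move: vj vt => /= vj vt; rewrite ?vj ?vt; lia.
- have [[vi _] [vs _]] := (vE i (ltn_trans is_ sN), vE s sN).
  by rewrite -!rmorphM colZ /= ?linearZ //; move: vi vs => /= vi vs; rewrite ?vi ?vs; lia.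
- have [[_ vj] [_ vt]] := (vE j (ltn_trans jt tN), vE t tN).
  have [[vi _] [vs _]] := (vE i iN, vE s (ltn_trans si iN)).
  by rewrite -!rmorphM antiZ /= //;
    move: vi vs vj vt => /= vi vs vj vt; rewrite ?vi ?vs ?vj ?vt; lia.
- have [[_ vj] [_ vt]] := (vE j (ltn_trans jt tN), vE t tN).
  have [[vi _] [vs _]] := (vE i (ltn_trans is_ sN), vE s sN).
  rewrite -!rmorphM diagZ /= ?raddfD /= ?linearZ //;
    move: vi vs vj vt => /= vi vs vj vt; rewrite ?vi ?vs ?vj ?vt; lia.
Qed.

Lemma frame_minor c d al be : diag_le c d ->
  c.1 = (o.1 + al)%N :> nat -> c.2 = (o.2 + be)%N :> nat ->
  iota (solid_minor Z c d) =
  qdet p (d.1 - c.1).+1 (fun k l => U (al + k) (be + l)).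
Proof.
move=> cd c1 c2; apply: solid_minor_qdet => // k l kr lr; rewrite /U.
have := cd => /andP[cd1 /eqP cd2]; have := ltn_ord d.1; have := ltn_ord d.2 => d2 d1.
congr (iota (Z _ _)); apply: val_inj; rewrite /= !insubdE //; lia.
Qed.

(** A diagonal other than that of [o] meets both lines in the same point. A point of the diagonal of
    [o] before [o] is above both lines, and its minor runs to the border in either case. *)
Lemma line_variable_off_diag w : ~~ on_diag w ->
  line_variable Z L1 w = line_variable Z L2 w.
Proof.
move=> w_off; have [z zL2 zw] := proj2 st2 w.
have oL2 : o \in L2 by rewrite L2E !inE eqxx.
have [zo|zo] := eqVneq z o.
  have wo : (w.1 < o.1)%N.
    move: w_off; rewrite /on_diag negb_and -ltnNge => /orP[|//].
    by rewrite -zo /same_diag eq_sym -[_ == _]/(same_diag z w) zw.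
  rewrite (line_variable_above Z st1 yL1) ?(line_variable_above Z st2 oL2) //.
    by rewrite /diag_lt wo; move: zw; rewrite zo /same_diag => /eqP; lia.
  by rewrite /diag_lt; move: zw; rewrite zo /same_diag => /eqP; lia.
have zL1 : z \in L1 by move: zL2; rewrite L2E !inE (negbTE zo) => /andP[].
have [le_zw|lt_wz] := leqP z.1 w.1.
  have zw' : diag_le z w by rewrite /diag_le le_zw.
  by rewrite (line_variable_below Z st1 zL1 zw') (line_variable_below Z st2 zL2 zw').
have wz : diag_lt w z by rewrite /diag_lt lt_wz eq_sym.
by rewrite (line_variable_above Z st1 zL1 wz) (line_variable_above Z st2 zL2 wz).
Qed.

Lemma line_variable2_diag s : (s <= T)%N ->
  line_variable Z L2 (dpt s) = solid_minor Z o (dpt s).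
Proof.
move=> sT; have [d1 d2] := dptE sT; apply: line_variable_below => //.
  by rewrite L2E !inE eqxx.
by rewrite /diag_le d1 d2; lia.
Qed.

Lemma line_variable1_diag s : (s < T)%N ->
  line_variable Z L1 (dpt s.+1) = solid_minor Z y (dpt s.+1).
Proof.
move=> sT; have [d1 d2] := dptE sT; apply: line_variable_below => //.
by rewrite /diag_le d1 d2; lia.
Qed.

Lemma dpt0 : dpt 0 = o.
Proof. by have [d1 d2] := dptE (leq0n T); apply: point_eq; rewrite ?d1 ?d2 addn0. Qed.

Lemma dptT : dpt T = diag_end o.
Proof.
by have [d1 d2] := dptE (leqnn T); have [e1 e2] := end_val; apply: point_eq; lia.
Qed.

Lemma line_variable1_corner : line_variable Z L1 (dpt 0) = solid_minor Z o (dpt T).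
Proof.
rewrite dpt0 dptT; apply: (line_variable_above Z st1 yL1).
by rewrite /diag_lt; lia.
Qed.

Lemma iota_line_variable2_diag s : (s <= T)%N -> iota (line_variable Z L2 (dpt s)) = Fm s.
Proof.
move=> sT; have [d1 d2] := dptE sT; rewrite line_variable2_diag //.
rewrite (@frame_minor o (dpt s) 0 0) ?addn0 //; last by rewrite /diag_le d1 d2; lia.
by rewrite d1 addKn.
Qed.

Lemma iota_line_variable1_diag s : (s < T)%N ->
  iota (line_variable Z L1 (dpt s.+1)) = Gm s.
Proof.
move=> sT; have [d1 d2] := dptE sT; rewrite line_variable1_diag //.
rewrite (@frame_minor y (dpt s.+1) 1 1) ?addn1 //; last first.
  by rewrite /diag_le d1 d2; lia.
by rewrite d1 y1 addnS subSS addKn.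
Qed.

Lemma line_variable_unit L w : staircase L ->
  iota (line_variable Z L w) \is a GRing.unit.
Proof.
move=> stL; have [unitD iotaI _] := hD; apply: unitD; rewrite raddf_eq0 //.
have [z zL zw] := proj2 stL w; have [le_zw|lt_wz] := leqP z.1 w.1.
  have zw' : diag_le z w by rewrite /diag_le le_zw.
  by rewrite (line_variable_below Z stL zL zw'); apply: solid_minor_neq0.
have wz : diag_lt w z by rewrite /diag_lt lt_wz eq_sym.
rewrite (line_variable_above Z stL zL wz); apply: solid_minor_neq0 => //.
by case: (diag_endP w).
Qed.

Let rank s := enum_rank (dpt s).

(** For s < T the minor stops before the last row and column; as solid minors are determined by
    their corners, it is not a covariant. *)
Lemma mem_mutable2 s : (s < T)%N -> rank s \in line_mutable Z L2.
Proof.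
move=> sT; have [d1 d2] := dptE (ltnW sT); rewrite inE enum_rankK.
rewrite line_variable2_diag ?(ltnW sT) //.
apply/covariantsP => -[c [d [_ dE cd]]].
have od : diag_le o (dpt s) by rewrite /diag_le d1 d2; lia.
case/(solid_minor_inj hA od cd) => _ ds; rewrite -ds d1 d2 in dE.
have [e1 e2] := end_val.
by have := ltn_ord (diag_end o).1; have := ltn_ord (diag_end o).2; lia.
Qed.

Lemma mem_mutable1 s : (s < T)%N -> rank s.+1 \in line_mutable Z L1.
Proof.
move=> sT; have [d1 d2] := dptE sT; rewrite inE enum_rankK line_variable1_diag //.
apply/covariantsP => -[c [d [cE _ cd]]].
have od : diag_le y (dpt s.+1) by rewrite /diag_le d1 d2; lia.
by case/(solid_minor_inj hA od cd) => yc _; rewrite -yc in cE; lia.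
Qed.

(* [F_s], which becomes [G_s], sits at position [s] of the diagonal for [L2], and
   [G_s] at position [s.+1] for [L1]; the common minor [F_T] moves from the last
   position to the corner. *)
Let next w : point m n :=
  if on_diag w then dpt (if (w.1 - o.1 == T)%N then 0 else (w.1 - o.1).+1) else w.

Let next_dpt s : (s <= T)%N -> next (dpt s) = dpt (if s == T then 0 else s.+1).
Proof.
by move=> sT; rewrite /next on_diag_dpt //; have [-> _] := dptE sT; rewrite addKn.
Qed.

Let next_inj : injective next.
Proof.
have dpt_inj s t : (s <= T)%N -> (t <= T)%N -> dpt s = dpt t -> s = t.
  by move=> sT tT e; have := dptE sT; have := dptE tT; rewrite e; lia.
have on_next w : on_diag (next w) = on_diag w.
  rewrite {1}/next; case: ifP => // w_on; apply: on_diag_dpt.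
  by have [s sT [_ ->]] := on_diagP w_on; case: ifP => // ?; lia.
move=> w w' eq_w; have := on_next w'; rewrite -eq_w on_next.
have [w_on|w_off] := boolP (on_diag w); last first.
  move: eq_w; rewrite /next (negbTE w_off) => eq_w /esym w'_off.
  by rewrite w'_off in eq_w.
move=> /esym /on_diagP[s' s'T [w'E _]]; have [s sT [wE _]] := on_diagP w_on.
move: eq_w; rewrite w'E wE !next_dpt // => /dpt_inj.
case: (eqVneq s T) => [->|sT']; case: (eqVneq s' T) => [->|s'T'] // eq_s.
- by have := eq_s (leq0n _) _; lia.
- by have := eq_s _ (leq0n _); lia.
- by have [] : s.+1 = s'.+1; [apply: eq_s; lia | move=> ->].
Qed.

Let sigma_fun (k : 'I_#|{: point m n}|) := enum_rank (next (enum_val k)).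

Let sigma_inj : injective sigma_fun.
Proof. by move=> k l /enum_rank_inj /next_inj /enum_val_inj. Qed.

Let sigma : 'S_#|{: point m n}| := perm sigma_inj.

(* The variables after [t] mutations. *)
Let tvar t (k : 'I_#|{: point m n}|) : D :=
  if on_diag (enum_val k) && ((enum_val k).1 < o.1 + t)%N
  then Gm ((enum_val k).1 - o.1) else iota (line_variable Z L2 (enum_val k)).

Let tvar_rank t s : (s <= T)%N -> tvar t (rank s) = if (s < t)%N then Gm s else Fm s.
Proof.
move=> sT; have [d1 d2] := dptE sT.
rewrite /tvar enum_rankK on_diag_dpt // d1 ltn_add2l addKn /=.
by case: ifP => // _; rewrite iota_line_variable2_diag.
Qed.

Let tvar_off t (k : 'I_#|{: point m n}|) : ~~ on_diag (enum_val k) ->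
  tvar t k = iota (line_variable Z L2 (enum_val k)).
Proof. by rewrite /tvar => /negbTE ->. Qed.

Let tvar0 k : tvar 0 k = iota (line_variable Z L2 (enum_val k)).
Proof.
rewrite /tvar addn0; case: ifP => // /andP[/andP[_ ow]].
by rewrite ltnNge ow.
Qed.

Let on_diag_rank (k : 'I_#|{: point m n}|) : on_diag (enum_val k) ->
  exists2 s, (s <= T)%N & k = rank s.
Proof.
by move=> /on_diagP[s sT [ks _]]; exists s; rewrite // /rank -ks enum_valK.
Qed.

Let sigma_rank s : (s <= T)%N -> sigma (rank s) = rank (if s == T then 0 else s.+1).
Proof. by move=> sT; rewrite permE /sigma_fun enum_rankK next_dpt. Qed.

Let sigma_off (k : 'I_#|{: point m n}|) : ~~ on_diag (enum_val k) -> sigma k = k.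
Proof.
by move=> k_off; rewrite permE /sigma_fun /next (negbTE k_off) enum_valK.
Qed.

Lemma tvarT k : tvar T k = iota (line_variable Z L1 (enum_val (sigma k))).
Proof.
have [/on_diag_rank[s sT ->]|k_off] := boolP (on_diag (enum_val k)); last first.
  by rewrite tvar_off // sigma_off // line_variable_off_diag.
rewrite tvar_rank // sigma_rank // enum_rankK ltn_neqAle sT andbT.
case: eqVneq => [sT'|sT'] /=; last by rewrite iota_line_variable1_diag //; lia.
by rewrite line_variable1_corner -line_variable2_diag // iota_line_variable2_diag // sT'.
Qed.

Lemma line_mutable_sigma :
  line_mutable Z L1 = [set sigma i | i in line_mutable Z L2].
Proof.
have mem_sigma k : (sigma k \in line_mutable Z L1) = (k \in line_mutable Z L2).
  have [/on_diag_rank[s sT ->]|k_off] := boolP (on_diag (enum_val k)); last first.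
    by rewrite sigma_off // !inE line_variable_off_diag.
  rewrite sigma_rank //; case: eqVneq => [->|sT'].
    by rewrite !inE !enum_rankK line_variable1_corner line_variable2_diag.
  by rewrite mem_mutable1 ?mem_mutable2 //; lia.
apply/setP => k; rewrite -[k](permKV sigma) mem_sigma.
by rewrite (mem_imset _ _ (@perm_inj _ sigma)).
Qed.

Lemma tvar_unit t k : (t <= T)%N -> tvar t k \is a GRing.unit.
Proof.
move=> tT; have [/on_diag_rank[s sT ->]|k_off] := boolP (on_diag (enum_val k)).
  rewrite tvar_rank //; case: ifP => st.
    by rewrite -iota_line_variable1_diag ?line_variable_unit //; lia.
  by rewrite -iota_line_variable2_diag ?line_variable_unit.
by rewrite tvar_off // line_variable_unit.
Qed.

(** * The chain from [Q2] to [Q1] *)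

Variables (Q1 : seed D (line_mutable Z L1)) (Q2 : seed D (line_mutable Z L2)).
Hypotheses (hQ1 : line_quantum_seed iota Q1) (hQ2 : line_quantum_seed iota Q2).

Let q_qcomm1 (i j : 'I_#|{: point m n}|) : exists s : int, qcomm (q ^ s)
  (iota (line_variable Z L1 (enum_val i))) (iota (line_variable Z L1 (enum_val j))).
Proof.
have [[[_ comm1] _] var1] := hQ1; exists (2 * Lambda Q1 i j).
by rewrite -!var1; apply: comm1.
Qed.

(** Off the diagonal, and on it at positions s < t, the variable belongs to V_{L1} along with G_t.
    At positions s > t it is F_s, which commutes with the entries of its matrix and so with G_t. *)
Lemma Gm_qcomm t (k : 'I_#|{: point m n}|) : (t < T)%N -> k != rank t ->
  exists s : int, qcomm (q ^ s) (Gm t) (tvar t k).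
Proof.
move=> tT kt; have GmE := iota_line_variable1_diag tT.
have [k_on|k_off] := boolP (on_diag (enum_val k)); last first.
  have [s comm_s] := q_qcomm1 (rank t.+1) k; exists s.
  by move: comm_s; rewrite enum_rankK GmE tvar_off // line_variable_off_diag.
have [s sT ks] := on_diag_rank k_on; rewrite ks tvar_rank //.
have [st|ts] := ltnP s t.
  have [e comm_e] := q_qcomm1 (rank t.+1) (rank s.+1); exists e.
  by move: comm_e; rewrite !enum_rankK GmE iota_line_variable1_diag //; lia.
have {}ts : (t < s)%N.
  by rewrite ltn_neqAle ts andbT; apply: contraNneq kt => ->; rewrite ks.
exists 0; rewrite /qcomm scale1r; apply/esym/comm_qdet => k' l kt' lt'.
by apply: qdet_central; rewrite ?expf_neq0 ?q_neq0 //; [apply: frame_qmat|..]; lia.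
Qed.

Section Step.

Variables (t : nat) (S : seed D (line_mutable Z L2)).
Hypotheses (tT : (t < T)%N) (seedS : is_quantum_seed S) (varS : var S =1 tvar t).

Let c := enum_rank_in (mem_mutable2 tT) (rank t).

Let cE : enum_val c = rank t.
Proof. by rewrite enum_rankK_in // mem_mutable2. Qed.

(** P and Q are the minors that end one column to the right of, and one row below, the last point of
    F_t; they start at [a] and [b]. *)
Let kP : 'I_#|{: point m n}| := enum_rank ((dpt t).1, (dpt t.+1).2).
Let kQ : 'I_#|{: point m n}| := enum_rank ((dpt t.+1).1, (dpt t).2).

Let off_P : ~~ on_diag (enum_val kP).
Proof.
have [d1 d2] := dptE tT; have [e1 e2] := dptE (ltnW tT).
by rewrite enum_rankK /on_diag /same_diag /= d2 e1; lia.
Qed.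

Let off_Q : ~~ on_diag (enum_val kQ).
Proof.
have [d1 d2] := dptE tT; have [e1 e2] := dptE (ltnW tT).
by rewrite enum_rankK /on_diag /same_diag /= d1 e2; lia.
Qed.

Let Pm := qdet p t.+1 (fun k l => U k l.+1).
Let Qm := qdet p t.+1 (fun k l => U k.+1 l).
Let Mm := qdet p t (fun k l => U k.+1 l.+1).

Let varP : var S kP = Pm.
Proof.
have [d1 d2] := dptE tT; have [e1 e2] := dptE (ltnW tT).
have aL2 : a \in L2.
  rewrite L2E !inE aL1 andbT; apply/orP; right; apply/eqP => ay.
  by move: y1; rewrite -ay a1; lia.
have aP : diag_le a (enum_val kP).
  by rewrite enum_rankK /diag_le /= d2 e1 a1 a2 y2; lia.
rewrite varS tvar_off // (line_variable_below Z st2 aL2 aP).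
rewrite (frame_minor (al := 0) (be := 1) aP) ?a1 ?a2 ?y2 ?addn0 ?addn1 //.
by rewrite enum_rankK /= e1 addKn.
Qed.

Let varQ : var S kQ = Qm.
Proof.
have [d1 d2] := dptE tT; have [e1 e2] := dptE (ltnW tT).
have bL2 : b \in L2.
  rewrite L2E !inE bL1 andbT; apply/orP; right; apply/eqP => yb.
  by move: y2; rewrite -yb b2; lia.
have bQ : diag_le b (enum_val kQ).
  by rewrite enum_rankK /diag_le /= d1 e2 b1 b2 y1; lia.
rewrite varS tvar_off // (line_variable_below Z st2 bL2 bQ).
rewrite (frame_minor (al := 1) (be := 0) bQ) ?b1 ?b2 ?y1 ?addn0 ?addn1 //.
by rewrite enum_rankK /= d1 addnS subSS addKn.
Qed.

Let varF : var S (rank t) = Fm t.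
Proof. by rewrite varS tvar_rank ?ltnn // ltnW. Qed.

Let varD : var S (rank t.+1) = Fm t.+1.
Proof. by rewrite varS tvar_rank // ltnNge leqnSn. Qed.

Let p_neq0 : p != 0.
Proof. by rewrite expf_neq0 ?q_neq0. Qed.

Let qU : qmat p t.+2 U.
Proof. exact: frame_qmat. Qed.

Let xU (k : 'I_#|{: point m n}|) : var S k \is a GRing.unit.
Proof. by rewrite varS tvar_unit // ltnW. Qed.

Let regD x : Fm t.+1 * x = 0 -> x = 0.
Proof. by rewrite -varD => Dx; apply: (mulrI (xU (rank t.+1))); rewrite mulr0. Qed.

Let commDF : GRing.comm (Fm t.+1) (Fm t).
Proof. by apply: comm_qdet => k l kt lt; apply: qdet_central => //; lia. Qed.

Let commDM : GRing.comm (Fm t.+1) Mm.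
Proof. by apply: comm_qdet => k l kt lt; apply: qdet_central => //; lia. Qed.

Let commFM : GRing.comm (Fm t) Mm.
Proof.
apply: comm_qdet => k l kt lt; apply: qdet_central => //; [|lia..].
by apply: qmat_le qU.
Qed.

(** After [t] mutations G_{t-1} sits at position t - 1. For t = 0 it is the empty determinant 1 and
    contributes no exponent. *)
Let wA : 'rV[int]_#|{: point m n}| :=
  delta_mx 0 (rank t.+1) + (if t is t'.+1 then delta_mx 0 (rank t') else 0).
Let wB : 'rV[int]_#|{: point m n}| := delta_mx 0 kP + delta_mx 0 kQ.

Let XA_E : monomial (var S) (Lambda S) wA = Fm t.+1 * Mm.
Proof.
have varM t' : t = t'.+1 -> var S (rank t') = Mm.
  by move=> tE; rewrite varS tvar_rank ?tE ?leqnn; [rewrite /Mm tE | lia].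
rewrite /wA; case tE : {2}t => [|t'].
  by rewrite addr0 (monomial_delta (var S)) varD /Mm tE qdet0 mulr1.
by rewrite (monomial_delta2 xU (proj1 seedS)) varD (varM t').
Qed.

Let XB_E : monomial (var S) (Lambda S) wB = Pm * Qm.
Proof.
rewrite /wB (monomial_delta2 xU (proj1 seedS)) varP varQ //.
exact: qdet_off_diagonal_comm.
Qed.

Lemma flip_step : exists S1 : seed D (line_mutable Z L2),
  [/\ is_quantum_seed S1, B_modification S S1,
      principal_part (Bmx S1) = principal_part (Bmx S) &
      exists S2, [/\ is_quantum_seed S2, mutation_move S1 S2 & var S2 =1 tvar t.+1]].
Proof.
have w_ge0 (k : 'I_#|{: point m n}|) : 0 <= wA 0 k /\ 0 <= wB 0 k.
  by split; rewrite mxE addr_ge0 //; case: (t) => [|t'];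
    rewrite ?mxE ?ler0n.
have w_disjoint (k : 'I_#|{: point m n}|) : wA 0 k = 0 \/ wB 0 k = 0.
  (* [wA] is supported on the diagonal of [o] and [wB] on the two adjacent diagonals. *)
  have [k_on|k_off] := boolP (on_diag (enum_val k)); [right|left].
    have kP_k : (k == kP) = false by apply: contraTF k_on => /eqP ->; apply: off_P.
    have kQ_k : (k == kQ) = false by apply: contraTF k_on => /eqP ->; apply: off_Q.
    by rewrite !mxE kP_k kQ_k.
  have kr s : (s <= T)%N -> (k == rank s) = false.
    by move=> sT; apply: contraNF k_off => /eqP ->; rewrite enum_rankK on_diag_dpt.
  rewrite mxE /=; case: (t) tT => [|t'] t'T; rewrite !mxE !kr //; lia.
have exchange : Gm t * var S (enum_val c) =
    monomial (var S) (Lambda S) wA + q ^ (- 2) *: monomial (var S) (Lambda S) wB.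
  (* The Dodgson identity carries a factor q^2 on all terms but P Q; cancelling it leaves q^(-2)
     there. *)
  rewrite cE varF XA_E XB_E; apply: (scalerI p_neq0).
  rewrite (quantum_dodgson p_neq0 qU) scalerDr scalerA.
  by rewrite (_ : p * q ^ (-2) = 1) ?scale1r // mulfV.
have commA : qcomm 1 (var S (enum_val c)) (monomial (var S) (Lambda S) wA).
  by rewrite cE varF XA_E /qcomm scale1r; apply: commrM (commr_sym commDF) commFM.
have commB : qcomm (q ^ 4) (var S (enum_val c)) (monomial (var S) (Lambda S) wB).
  (* Passing P and then Q costs p = q^2 each time. *)
  rewrite cE varF XB_E /qcomm mulrA (qdet_comm_shift_col p_neq0 qU regD).
  rewrite -scalerAl -mulrA (qdet_comm_shift_row p_neq0 qU regD).
  rewrite -scalerAr scalerA (_ : p * p = q ^ 4); last by rewrite /p -exprD.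
  by rewrite mulrA.
have commG (k : 'I_#|{: point m n}|) : k != enum_val c ->
    exists s : int, qcomm (q ^ s) (Gm t) (var S k).
  by rewrite cE varS; apply: Gm_qcomm.
pose S1 := exchange_seed S c wA wB.
have seedS1 : is_quantum_seed S1 by apply: exchange_seed_quantum exchange _ _ _.
exists S1; split=> //; first exact: exchange_seed_principal exchange _ _ _.
exists (mutate S1 c); split; [exact: mutate_quantum_seed | by exists c |].
move=> k; rewrite ffunE cE (exchange_seed_mutated (G := Gm t)) //.
case: eqVneq => [->|kt]; first by rewrite tvar_rank ?ltnSn // ltnW.
rewrite varS; have [/on_diag_rank[s sT ks]|k_off] := boolP (on_diag (enum_val k));
  last by rewrite !tvar_off.
rewrite ks !tvar_rank // ltnS [(s <= t)%N]leq_eqVlt.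
by case: eqVneq => [st|//]; rewrite ks st eqxx in kt.
Qed.

End Step.

Lemma flip_chain t : (t <= T)%N ->
  exists2 S, seed_chain Q2 (2 * t) S & var S =1 tvar t.
Proof.
elim: t => [|t IH] tT.
  exists Q2; first exact: seed_chain0 (proj1 hQ2).
  by move=> k; rewrite tvar0 (proj2 hQ2).
have [S chainS varS] := IH (ltnW tT).
have [S1 [seed1 mod1 prin1 [S2 [seed2 mut2 var2]]]] :=
  flip_step tT (seed_chain_quantum chainS) varS.
exists S2 => //; rewrite mulnS; apply: (@seed_chainS _ _ _ _ _ S1) => //.
  by apply: (@seed_chainS _ _ _ _ _ S) => //; rewrite /seed_step oddM.
by rewrite /seed_step /= oddM.
Qed.

Lemma flip_transport (S : seed D (line_mutable Z L2)) :
  is_quantum_seed S -> var S =1 tvar T -> exists S' : seed D (line_mutable Z L2),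
  [/\ is_quantum_seed S', B_modification S S',
      principal_part (Bmx S') = principal_part (Bmx S) & same_seed S' Q1].
Proof.
move=> seedS varS; have [[LaQ1 compQ1] varQ1] := hQ1.
have mem_sigma (c : 'I_#|line_mutable Z L2|) : sigma (enum_val c) \in line_mutable Z L1.
  by rewrite line_mutable_sigma imset_f ?enum_valP.
pose h (c : 'I_#|line_mutable Z L2|) := enum_rank_in (mem_sigma c) (sigma (enum_val c)).
have hE c : enum_val (h c) = sigma (enum_val c) by rewrite enum_rankK_in.
have LaE i j : Lambda Q1 (sigma i) (sigma j) = Lambda S i j.
  pose La := \matrix_(i, j) Lambda Q1 (sigma i) (sigma j).
  have varU k : var S k \is a GRing.unit by rewrite varS tvar_unit.
  rewrite -(Lambda_matrix_unique (La := La) varU _ (proj1 seedS)) ?mxE //.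
  split=> [|k l]; last by rewrite !varS !tvarT -!varQ1 mxE; apply: (proj2 LaQ1).
  apply/matrixP => k l; rewrite !mxE.
  by have := congr1 (fun M : 'M_#|_| => M (sigma k) (sigma l)) (proj1 LaQ1); rewrite !mxE.
pose B := \matrix_(k, c) Bmx Q1 (sigma k) (h c).
have compB : compatible_pair (Lambda S) B.
  move=> c i; rewrite -(inj_eq (@perm_inj _ sigma)) -hE -compQ1.
  rewrite [RHS](reindex_inj (@perm_inj _ sigma)) /=.
  by apply: eq_bigr => k _; rewrite mxE LaE.
exists {| var := var S; Lambda := Lambda S; Bmx := B |}; split=> //.
- by split=> //; apply: (proj1 seedS).
- exact: (compatible_principal (proj1 (proj1 seedS)) (proj2 seedS) compB).
exists sigma; split=> //=; first exact: line_mutable_sigma.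
  by move=> k; rewrite varS tvarT varQ1.
move=> k c c' cc'; rewrite mxE; congr (Bmx Q1 _ _).
by apply: enum_val_inj; rewrite hE.
Qed.

Lemma flip_seed_chain : exists len, exists2 S, seed_chain Q2 len S & same_seed S Q1.
Proof.
have [S chainS varS] := flip_chain (leqnn T).
have [S' [seedS' modS' prinS' sameS']] :=
  flip_transport (seed_chain_quantum chainS) varS.
(* The final modification has the even index 2 T, so it continues the alternation after the last
   mutation. *)
exists (2 * T).+1, S' => //; apply: (@seed_chainS _ _ _ _ _ S) => //.
by rewrite /seed_step oddM.
Qed.

End Flip.

Theorem theorem6p20 (m n : nat) (A : algType K) (Z : 'I_m -> 'I_n -> A)
    (hA : is_qmatrix_algebra Z)
    (D : unitAlgType K) (iota : {lrmorphism A -> D})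
    (hD : is_skew_field_of_fractions iota)
    (L1 L2 : {set 'I_m * 'I_n})
    (hL1 : broken_line L1) (hL2 : broken_line L2)
    (hL : closest_bigger L1 L2)
    (Q1 : seed D (line_mutable Z L1)) (Q2 : seed D (line_mutable Z L2))
    (hQ1 : line_quantum_seed iota Q1) (hQ2 : line_quantum_seed iota Q2) :
  exists (len : nat) (first : bool) (Q : nat -> seed D (line_mutable Z L2)),
    [/\ Q 0%N = Q2,
        same_seed (Q len) Q1,
        forall k, (k <= len)%N -> is_quantum_seed (Q k)
      & forall k, (k < len)%N ->
          if odd k == first then mutation_move (Q k) (Q k.+1)
          else B_modification (Q k) (Q k.+1) /\
               principal_part (Bmx (Q k.+1)) = principal_part (Bmx (Q k))].
Proof.
have st1 := broken_line_staircase hL1; have st2 := broken_line_staircase hL2.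
have [o [y [a [b [[y1 y2] [[a1 b2] [a2 b1]] [yL aL bL] L2E]]]]] :=
  closest_bigger_flip hL1 hL2 hL.
have [len [S [Q [Q0 QS seedQ stepQ]] sameS]] :=
  flip_seed_chain hA hD st1 st2 y1 y2 a1 a2 b1 b2 yL aL bL L2E hQ1 hQ2.
by exists len, true, Q; split=> //; rewrite QS.
Qed.
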